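(* The affine index polynomial is an invariant of virtual knotoids and of classical knotoids: if $K$ and $K'$ are virtually equivalent virtual knotoid diagrams, or equivalent classical knotoid diagrams, then $P_K(t)=P_{K'}(t)$.
   Context: A (classical) knotoid diagram in $S^2$ (or $\mathbb{R}^2$) is a generic immersion of $[0,1]$ whose only singularities are finitely many transversal double points with over/under information (classical crossings). The images of $0$ and $1$ (tail and head) are distinct from each other and from the crossings; the diagram is oriented from tail to head. The $\Omega$-moves are the Reidemeister moves $\Omega_1,\Omega_2,\Omega_3$ performed inside small disks not containing the endpoints (pulling the strand adjacent to an endpoint over or under another strand is not allowed). Classical knotoid diagrams are equivalent if related by finitely many $\Omega$-moves and isotopy of $S^2$ (resp. $\mathbb{R}^2$). A virtual knotoid diagram is a knotoid diagram in $S^2$ in which some double points are virtual crossings (no over/under information). Virtual knotoid diagrams are virtually equivalent if they are related by finitely many $\Omega$-moves, detour moves, and isotopy of $S^2$. Detour move: a segment whose crossings are all virtual may be replaced by any other segment with the same ends, all of whose crossings with the rest of the diagram are declared virtual; this includes the move $\Omega_v$, by which the strand adjacent to the tail or head may be slid back or forth, deleting or creating consecutive virtual crossings on it. Affine index polynomial. Let $F(K)$ be the underlying flat diagram of $K$, obtained by forgetting the over/under information at classical crossings (virtual crossings are kept). Its arcs are the edges between consecutive vertices, where the vertices are the flat (formerly classical) crossings and the two endpoints; virtual crossings are not vertices. Label the arcs by integers: the first arc (starting at the tail) has label $0$. At each flat crossing, drawn with both strands oriented upwards, the strand going from bottom right to top left has its label increased by $1$ and the strand going from bottom left to top right has its label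 decreased by $1$; labels do not change at virtual crossings. For a classical crossing $c$ let $a$ and $b$ be the labels of the left and right incoming arcs at the corresponding flat crossing, and set $w_+(c)=a-(b+1)$, $w_-(c)=b-(a-1)$. The weight $w_K(c)$ is $w_+(c)$ if $c$ is positive and $w_-(c)$ if $c$ is negative. Then $P_K(t)=\sum_c \mathrm{sgn}(c)(t^{w_K(c)}-1)\in\mathbb{Z}[t,t^{-1}]$, the sum over all classical crossings, with $\mathrm{sgn}(c)=\pm1$ the sign of $c$. *)

(* Defs.v *)
From HB Require Import structures.
From Stdlib Require Export Relation_Operators.
From mathcomp Require Export all_boot all_order all_algebra.
From mathcomp Require Export all_classical all_reals all_analysis.
Export Order.TTheory GRing.Theory Num.Theory.
Export numFieldNormedType.Exports.

Set Implicit Arguments.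
Unset Strict Implicit.
Unset Printing Implicit Defensive.

Local Open Scope classical_set_scope.
Local Open Scope ring_scope.

(* For maps between finite-dimensional spaces (the only use below), continuity
   of every directional derivative is continuity of the differential. *)
Definition C1 (R : realType) (U V : normedModType R) (f : U -> V) : Prop :=
  (forall x, differentiable f x) /\
  (forall v, continuous (fun x : U => 'd f x v)).

(* Both surfaces are embedded in R^3: S2 is the unit sphere with outward normal,
   R2 the plane z = 0 with upward normal. Tangent frames are oriented by the
   normal. *)
Inductive surface := S2 | R2.

Definition on (R : realType) (S : surface) (p : 'rV[R]_3) : Prop :=
  match S with
  | S2 => \sum_(i < 3) p ord0 i ^+ 2 = 1
  | R2 => p ord0 ord_max = 0
  end.

Definition normal (R : realType) (S : surface) (p : 'rV[R]_3) : 'rV[R]_3 :=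
  match S with
  | S2 => p
  | R2 => delta_mx ord0 ord_max
  end.

(* The oriented area of the tangent vectors v, w at p. *)
Definition area (R : realType) (S : surface) (p v w : 'rV[R]_3) : R :=
  \det (\matrix_(i < 3) nth 0 [:: v; w; normal S p] i).

(* How the strand passing at a given parameter meets the other strand. *)
Inductive passing := Over | Under | Virtual.

Definition matching (x y : passing) : Prop :=
  match x, y with
  | Over, Under | Under, Over | Virtual, Virtual => True
  | _, _ => False
  end.

Definition double (R : realType) (c : R -> 'rV[R]_3) (u v : R) : Prop :=
  [/\ 0 <= u <= 1, 0 <= v <= 1, u <> v & c u = c v].

(* A possibly virtual knotoid diagram. A C^1 map on [0,1] is represented by any
   C^1 extension of it to R; the values of the curve outside [0,1], and of the
   tags at parameters that are not passes through double points, are junk. *)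
Record diagram (R : realType) (S : surface) := Diagram {
  curve : R -> 'rV[R]_3;
  tag : R -> passing;
  curve_C1 : C1 (curve : R^o -> 'rV[R]_3);
  curve_on : forall u, 0 <= u <= 1 -> on S (curve u);
  curve_immersion : forall u, 0 <= u <= 1 -> derive1 curve u <> 0;
  double_finite : finite_set [set p : R * R | double curve p.1 p.2];
  double_at_most : forall u v w,
    double curve u v -> double curve u w -> v = w;
  double_transversal : forall u v,
    double curve u v -> area S (curve u) (derive1 curve u) (derive1 curve v) <> 0;
  double_not_end : forall u v, double curve u v -> 0 < u < 1;
  tag_matching : forall u v, double curve u v -> matching (tag u) (tag v)
}.

Definition classical (R : realType) (S : surface) (K : diagram R S) : Prop :=
  forall u v, double (curve K) u v -> tag K u <> Virtual.

(* (u, v) is an ordered pair of passes through the same non-virtual crossing: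
   each such crossing gives two pairs. *)
Definition flat_pair (R : realType) (S : surface) (K : diagram R S) :
    set (R * R) :=
  [set p | double (curve K) p.1 p.2 /\ tag K p.1 <> Virtual].

(* With both strands drawn upwards, the pass at p.1 runs from bottom left to top
   right and the pass at p.2 from bottom right to top left. *)
Definition left_incoming (R : realType) (S : surface) (K : diagram R S)
    (p : R * R) : bool :=
  0 < area S (curve K p.1) (derive1 (curve K) p.1) (derive1 (curve K) p.2).

(* The change of the label along the strand passing at p.1. *)
Definition label_change (R : realType) (S : surface) (K : diagram R S)
    (p : R * R) : int :=
  if left_incoming K p then -1 else 1.

(* The label of the arc that contains u, or that arrives at the flat crossing
   passed at u: labels start from 0 at the tail and change only at flat
   crossings, so it is the sum of the changes met before u. *)
Definition label (R : realType) (S : surface) (K : diagram R S) (u : R) : int :=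
  \sum_(p \in [set p | flat_pair K p /\ p.1 < u]) label_change K p.

(* A classical crossing is the pair (parameter of its over-pass, parameter of
   its under-pass). *)
Definition crossing (R : realType) (S : surface) (K : diagram R S) :
    set (R * R) :=
  [set c | double (curve K) c.1 c.2 /\ tag K c.1 = Over].

(* Positive: the over-strand runs from bottom left to top right. *)
Definition positive (R : realType) (S : surface) (K : diagram R S)
    (c : R * R) : bool :=
  left_incoming K c.

Definition sgn (R : realType) (S : surface) (K : diagram R S)
    (c : R * R) : int :=
  if positive K c then 1 else -1.

Definition label_left (R : realType) (S : surface) (K : diagram R S)
    (c : R * R) : int :=
  if left_incoming K c then label K c.1 else label K c.2.

Definition label_right (R : realType) (S : surface) (K : diagram R S)
    (c : R * R) : int :=
  if left_incoming K c then label K c.2 else label K c.1.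

Definition w_plus (R : realType) (S : surface) (K : diagram R S)
    (c : R * R) : int :=
  label_left K c - (label_right K c + 1).

Definition w_minus (R : realType) (S : surface) (K : diagram R S)
    (c : R * R) : int :=
  label_right K c - (label_left K c - 1).

Definition weight (R : realType) (S : surface) (K : diagram R S)
    (c : R * R) : int :=
  if positive K c then w_plus K c else w_minus K c.

(* Z[t, 1/t] is regarded as a subring of the field of fractions of Z[t]. *)
Definition tvar : {fraction {poly int}} := tofrac 'X.

Definition affine_index_polynomial (R : realType) (S : surface)
    (K : diagram R S) : {fraction {poly int}} :=
  \sum_(c \in crossing K) (tvar ^ weight K c - 1) *~ sgn K c.

Definition diffeomorphism (R : realType) (S : surface)
    (f : 'rV[R]_3 -> 'rV[R]_3) : Prop :=
  (C1 f /\ forall p, on S p -> on S (f p)) /\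
  exists g : 'rV[R]_3 -> 'rV[R]_3,
    [/\ C1 g, forall p, on S p -> on S (g p),
        forall p, on S p -> g (f p) = p & forall p, on S p -> f (g p) = p].

Definition ambient_isotopy (R : realType) (S : surface)
    (H : R -> 'rV[R]_3 -> 'rV[R]_3) : Prop :=
  [/\ C1 (fun x : R^o * 'rV[R]_3 => H x.1 x.2),
      forall p, on S p -> H 0 p = p &
      forall s, 0 <= s <= 1 -> diffeomorphism S (H s)].

Definition isotopic (R : realType) (S : surface) (K K' : diagram R S) : Prop :=
  exists2 H : R -> 'rV[R]_3 -> 'rV[R]_3, ambient_isotopy S H &
    (forall u, 0 <= u <= 1 -> curve K' u = H 1 (curve K u)) /\
    (forall u v, double (curve K) u v -> tag K' u = tag K u).

(* An oriented curve is an immersion up to increasing change of parameter. *)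
Definition reparametrized (R : realType) (S : surface)
    (K K' : diagram R S) : Prop :=
  exists r : R -> R,
    [/\ C1 (r : R^o -> R^o), r 0 = 0 /\ r 1 = 1,
        forall u, 0 <= u <= 1 -> 0 < derive1 r u,
        forall u, 0 <= u <= 1 -> curve K' u = curve K (r u) &
        forall u v, double (curve K') u v -> tag K' u = tag K (r u)].

Definition pt (R : realType) (x y : R) : 'rV[R]_2 :=
  \row_(i < 2) nth 0 [:: x; y] i.

Definition in_square (R : realType) (q : 'rV[R]_2) : Prop :=
  forall i, -1 <= q ord0 i <= 1.

(* An embedding of the plane in S, of either orientation; the move takes place
   in the image of the square. *)
Definition chart (R : realType) (S : surface)
    (phi : 'rV[R]_2 -> 'rV[R]_3) : Prop :=
  [/\ C1 phi, forall q, on S (phi q), injective phi &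
      forall q v, 'd phi q v = 0 -> v = 0].

(* A picture with n strands in the square [-1,1]^2 is s : 'I_n -> R -> 'rV_2,
   every strand being parametrized by [-1,1]. Strand i is followed by a diagram
   at the parameters m i + d i * x with -1 <= x <= 1, backwards if d i < 0. *)

Definition inside (R : realType) (n : nat) (m d : 'I_n -> R) (u : R) : Prop :=
  exists i x, -1 <= x <= 1 /\ u = m i + d i * x.

Definition outside (R : realType) (n : nat) (m d : 'I_n -> R) (u : R) : Prop :=
  0 <= u <= 1 /\ ~ inside m d u.

(* K draws the picture s through phi. All the crossings drawn are classical;
   strands with larger h lie above, and at a self-crossing of a strand either
   pass may be the upper one. *)
Definition draws (R : realType) (S : surface) (n : nat)
    (s : 'I_n -> R -> 'rV[R]_2) (phi : 'rV[R]_2 -> 'rV[R]_3)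
    (h : 'I_n -> nat) (m d : 'I_n -> R) (K : diagram R S) : Prop :=
  [/\ forall i x, -1 <= x <= 1 -> curve K (m i + d i * x) = phi (s i x),
      forall u, outside m d u ->
        ~ exists2 q, in_square q & curve K u = phi q,
      forall i x y, -1 <= x <= 1 -> -1 <= y <= 1 -> x <> y ->
        s i x = s i y -> tag K (m i + d i * x) <> Virtual &
      forall i j x y, -1 <= x <= 1 -> -1 <= y <= 1 -> i != j ->
        s i x = s j y ->
        tag K (m i + d i * x) = if (h j < h i)%N then Over else Under].

(* K and K' coincide outside a disk free of endpoints, in which the picture s
   drawn by K is replaced by the picture s'. *)
Definition local_move (R : realType) (n : nat) (s s' : 'I_n -> R -> 'rV[R]_2)
    (S : surface) (K K' : diagram R S) : Prop :=
  exists phi : 'rV[R]_2 -> 'rV[R]_3, exists h : 'I_n -> nat,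
  exists m : 'I_n -> R, exists d : 'I_n -> R,
    [/\ chart S phi /\ injective h,
        (forall i, d i <> 0) /\
        (forall i x, -1 <= x <= 1 -> 0 < m i + d i * x < 1),
        forall i j x y, -1 <= x <= 1 -> -1 <= y <= 1 -> i != j ->
          m i + d i * x <> m j + d j * y,
        draws s phi h m d K /\ draws s' phi h m d K' &
        (forall u, outside m d u -> curve K' u = curve K u) /\
        (forall u v, outside m d u -> outside m d v ->
          double (curve K) u v -> tag K' u = tag K u)].

(* Standard pictures of the Reidemeister moves. They are bent by a bump that
   vanishes to first order at -1 and 1, so that both sides of a move have the
   same ends and the same end tangents. Mirror images come from the orientation
   of the chart, reversed strands from the signs of d, and the layers from h. *)

Definition bump (R : realType) (x : R) : R := (1 - x ^+ 2) ^+ 2.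

Definition line (R : realType) (x : R) : 'rV[R]_2 := pt x 0.

(* Crosses itself once, at x = 1/2 and x = -1/2. *)
Definition curl (R : realType) (x : R) : 'rV[R]_2 :=
  pt (x * (1 - 16 / 9 * bump x)) (1 / 2 * bump x).

Definition Omega1 (R : realType) (S : surface) (K K' : diagram R S) : Prop :=
  local_move (fun _ : 'I_1 => @line R) (fun _ : 'I_1 => @curl R) K K'.

Definition high (R : realType) (x : R) : 'rV[R]_2 := pt x (9 / 16).

(* Meets [line] twice, at x = 1/2 and x = -1/2. *)
Definition dip (R : realType) (x : R) : 'rV[R]_2 := pt x (9 / 16 - bump x).

Definition Omega2 (R : realType) (S : surface) (K K' : diagram R S) : Prop :=
  local_move (fun i : 'I_2 => nth (@line R) [:: @line R; @high R] i)
             (fun i : 'I_2 => nth (@line R) [:: @line R; @dip R] i) K K'.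

Definition rising (R : realType) (x : R) : 'rV[R]_2 := pt x (x / 2).
Definition falling (R : realType) (x : R) : 'rV[R]_2 := pt x (- x / 2).

(* [below] passes below the crossing of [rising] and [falling], meeting them at
   x = -1/2 and x = 1/2; [above] passes above it, meeting them at x = 1/2 and
   x = -1/2. *)
Definition below (R : realType) (x : R) : 'rV[R]_2 := pt x (- 1 / 4).
Definition above (R : realType) (x : R) : 'rV[R]_2 :=
  pt x (- 1 / 4 + 8 / 9 * bump x).

Definition Omega3 (R : realType) (S : surface) (K K' : diagram R S) : Prop :=
  local_move
    (fun i : 'I_3 => nth (@line R) [:: @rising R; @falling R; @below R] i)
    (fun i : 'I_3 => nth (@line R) [:: @rising R; @falling R; @above R] i)
    K K'.

Inductive omega_step (R : realType) (S : surface) (K K' : diagram R S) : Prop :=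
| step_isotopy of isotopic K K'
| step_parameter of reparametrized K K'
| step_Omega1 of Omega1 K K'
| step_Omega2 of Omega2 K K'
| step_Omega3 of Omega3 K K'.

Definition virtual_on (R : realType) (S : surface) (K : diagram R S)
    (A : set R) : Prop :=
  forall u v, A u -> double (curve K) u v -> tag K u = Virtual.

(* The segment over [a,b] is replaced. *)
Definition detour (R : realType) (S : surface) (K K' : diagram R S) : Prop :=
  exists a b : R,
    [/\ [/\ 0 <= a, a < b & b <= 1],
        virtual_on K [set u | a <= u <= b] /\
        virtual_on K' [set u | a <= u <= b],
        forall u, 0 <= u <= 1 -> ~ a < u < b -> curve K' u = curve K u &
        forall u v, ~ a <= u <= b -> ~ a <= v <= b ->
          double (curve K) u v -> tag K' u = tag K u].

(* The tail is slid forth to the parameter a and the head back to b, along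
   strands that have only virtual crossings. *)
Definition Omega_v (R : realType) (S : surface) (K K' : diagram R S) : Prop :=
  exists a b : R,
    [/\ [/\ 0 <= a, a < b & b <= 1],
        virtual_on K [set u | ~ a <= u <= b],
        forall u, 0 <= u <= 1 -> curve K' u = curve K (a + (b - a) * u) &
        forall u v, double (curve K') u v ->
          tag K' u = tag K (a + (b - a) * u)].

Inductive virtual_step (R : realType) (S : surface) (K K' : diagram R S) :
    Prop :=
| step_omega of omega_step K K'
| step_detour of detour K K'
| step_Omega_v of Omega_v K K'.

Definition virtually_equivalent (R : realType) (K K' : diagram R S2) : Prop :=
  clos_refl_sym_trans (diagram R S2) (@virtual_step R S2) K K'.

(* All intermediate diagrams are classical. *)
Definition classical_step (R : realType) (S : surface) (K K' : diagram R S) :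
    Prop :=
  [/\ classical K, classical K' & omega_step K K'].

Definition classically_equivalent (R : realType) (S : surface)
    (K K' : diagram R S) : Prop :=
  clos_refl_sym_trans (diagram R S) (@classical_step R S) K K'.

(* Main.v *)
From mathcomp Require Import ring lra zify.
Require Import Defs.

(* At a crossing c with over-pass o and under-pass u the weight is
   label o - label u - sgn c, whatever the sign. Isotopy, reparametrization,
   detours and Omega_v induce an order-preserving bijection of the passes through
   flat crossings that respects the signs; for an isotopy the sign of the oriented
   area of the two tangent vectors is constant in time because it is a continuous
   function without zeros. In a Reidemeister move the parameters inside the disk
   form disjoint blocks, one per strand, and the total change of the label along
   each block is the same on both sides, so labels outside the disk do not change.
   Inside, the crossing of Omega1 has weight 0, the two crossings of Omega2 have
   equal weights and opposite signs, and the three crossings of Omega3 keep their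
   signs and weights while every strand meets the other two in reverse order. *)

Set Implicit Arguments.
Unset Strict Implicit.
Unset Printing Implicit Defensive.

Local Open Scope classical_set_scope.
Local Open Scope ring_scope.

(** * Oriented area and tangent vectors *)

Section Area.
Context {R : realType}.
Implicit Types (S : surface) (p v w : 'rV[R]_3).

(** Signs are controlled by a continuous function without zeros on an interval. For an isotopy the
    obstacle is that each map of R^3 is invertible on the surface only, so its ambient differential
    may be singular; the argument therefore follows the velocities of the two strands at a crossing
    and recovers their independence through the inverse map. The same principle along a segment of
    the plane shows that a chart has a single orientation. Hence every sign inside a disk is a
    function of a few booleans: the senses of two strands, the orientation of the chart and the sign
    of a planar determinant. Strand senses, chart orientation and layers stay variable, so one
    computation settles all variants of a Reidemeister move. Since a label is a finite sum over
    passes and not a recursion along arcs, it splits into the contribution of the passes outside the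
    disk and one contribution per strand inside. The latter turn into sums over explicit lists of
    crossings. *)

Definition i0 : 'I_3 := @Ordinal 3 0 isT.
Definition i1 : 'I_3 := @Ordinal 3 1 isT.
Definition i2 : 'I_3 := @Ordinal 3 2 isT.

Definition dot v w : R := \sum_(i < 3) v ord0 i * w ord0 i.

Lemma sum3E (V : nmodType) (f : 'I_3 -> V) : \sum_(i < 3) f i = f i0 + f i1 + f i2.
Proof.
rewrite !big_ord_recl big_ord0 addr0 addrA.
by congr (f _ + f _ + f _); exact: val_inj.
Qed.

Lemma det3E (A : 'M[R]_3) :
  \det A = A i0 i0 * (A i1 i1 * A i2 i2 - A i1 i2 * A i2 i1)
         - A i0 i1 * (A i1 i0 * A i2 i2 - A i1 i2 * A i2 i0)
         + A i0 i2 * (A i1 i0 * A i2 i1 - A i1 i1 * A i2 i0).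
Proof.
rewrite (expand_det_row _ i0) sum3E /cofactor.
rewrite !(expand_det_row _ (@Ordinal 2 0 isT)) !big_ord_recl !big_ord0 /cofactor.
rewrite !(expand_det_row _ (@Ordinal 1 0 isT)) !big_ord_recl !big_ord0 /cofactor.
rewrite !det_mx00 !mxE.
(* Indices built from nested [lift] are normalized through their values, so that [ring] recognizes
   equal entries. *)
have E i j : A i j = A (inord (val i)) (inord (val j)) by rewrite !inord_val.
by do ![rewrite [A (lift _ _) _]E || rewrite [A _ (lift _ _)]E];
  rewrite ![A i0 _]E ![A i1 _]E ![A i2 _]E /= /bump /=; ring.
Qed.

Lemma areaE S p v w :
  area S p v w =
    (v ord0 i1 * w ord0 i2 - v ord0 i2 * w ord0 i1) * normal S p ord0 i0
  + (v ord0 i2 * w ord0 i0 - v ord0 i0 * w ord0 i2) * normal S p ord0 i1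
  + (v ord0 i0 * w ord0 i1 - v ord0 i1 * w ord0 i0) * normal S p ord0 i2.
Proof. by rewrite /area det3E !mxE /=; ring. Qed.

Lemma areaC S p v w : area S p w v = - area S p v w.
Proof. by rewrite !areaE; ring. Qed.

Lemma areaZ S p a b v w : area S p (a *: v) (b *: w) = a * b * area S p v w.
Proof. by rewrite !areaE !mxE; ring. Qed.

Lemma area_comb S p v w a b c d :
  area S p (a *: v + b *: w) (c *: v + d *: w) = (a * d - b * c) * area S p v w.
Proof. by rewrite !areaE !mxE; ring. Qed.

Lemma area_indep S p v w a b : area S p v w != 0 ->
  a *: v + b *: w = 0 -> a = 0 /\ b = 0.
Proof.
move=> A0 e; have a0 w' : area S p 0 w' = 0 by rewrite areaE !mxE; ring.
split; apply: (mulIf A0).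
  (* Cramer's rule: the area against [w] isolates [a], and below the area against [- v] isolates
     [b]. *)
  by rewrite mul0r -(a0 (0 *: v + 1 *: w)) -e area_comb; ring.
by rewrite mul0r -(a0 (- 1 *: v + 0 *: w)) -e area_comb; ring.
Qed.

Lemma normal_neq0 S p : on S p -> normal S p != 0.
Proof.
case: S => /= h; apply/eqP => p0.
  by move: h; rewrite p0 sum3E !mxE expr0n !addr0 => /eqP; rewrite eq_sym oner_eq0.
by move/matrixP/(_ ord0 ord_max)/eqP: p0; rewrite !mxE !eqxx oner_eq0.
Qed.

(** A vanishing determinant gives a relation among [v], [w] and the normal. Its scalar product with
    the normal kills the tangent vectors and leaves a multiple of the squared norm of the normal, so
    the normal has coefficient 0. *)
Lemma area_dependent S p v w : on S p ->
  dot v (normal S p) = 0 -> dot w (normal S p) = 0 -> area S p v w = 0 ->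
  exists a b, (a != 0 \/ b != 0) /\ a *: v + b *: w = 0.
Proof.
move=> onp vn wn /eqP/det0P[x x0 xM].
have E k : x ord0 i0 * v ord0 k + x ord0 i1 * w ord0 k + x ord0 i2 * normal S p ord0 k = 0.
  by move/matrixP/(_ ord0 k): xM; rewrite !mxE sum3E !mxE.
have x2 : x ord0 i2 = 0.
  have n0 : dot (normal S p) (normal S p) != 0.
    apply: contra (normal_neq0 onp) => /eqP; rewrite /dot sum3E.
    set a := normal S p ord0 i0; set b := normal S p ord0 i1; set c := normal S p ord0 i2.
    have sq0 (y : R) : y * y <= 0 -> y = 0.
      by move=> y0; apply/eqP; rewrite -[_ == 0]orbb -mulf_eq0 eq_le y0 -expr2 sqr_ge0.
    move=> h; have {h} [a0 b0 c0] : [/\ a = 0, b = 0 & c = 0].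
      by split; apply: sq0; move: h; have := sqr_ge0 a; have := sqr_ge0 b;
        have := sqr_ge0 c; rewrite !expr2; lra.
    apply/eqP/rowP => -[[|[|[|//]]] k]; rewrite mxE.
    - by rewrite -a0; congr (normal _ _ _ _); exact: val_inj.
    - by rewrite -b0; congr (normal _ _ _ _); exact: val_inj.
    - by rewrite -c0; congr (normal _ _ _ _); exact: val_inj.
  apply/eqP; rewrite -(mulIr_eq0 _ (mulIf n0)); apply/eqP.
  transitivity (x ord0 i0 * dot v (normal S p) + x ord0 i1 * dot w (normal S p)
                + x ord0 i2 * dot (normal S p) (normal S p)).
    by rewrite vn wn; ring.
  rewrite /dot !sum3E.
  transitivity (\sum_(k < 3) (x ord0 i0 * v ord0 k + x ord0 i1 * w ord0 k
      + x ord0 i2 * normal S p ord0 k) * normal S p ord0 k).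
    by rewrite sum3E; ring.
  by apply: big1 => k _; rewrite E mul0r.
exists (x ord0 i0), (x ord0 i1); split.
  case: (eqVneq (x ord0 i0) 0) => [h0|]; last by left.
  right; apply: contra x0 => /eqP h1; apply/eqP/rowP => -[[|[|[|//]]] k]; rewrite mxE.
  - by rewrite -h0; congr (x _ _); exact: val_inj.
  - by rewrite -h1; congr (x _ _); exact: val_inj.
  - by rewrite -x2; congr (x _ _); exact: val_inj.
by apply/rowP => k; rewrite !mxE; have := E k; rewrite x2; lra.
Qed.

Lemma is_derive_coord (c : R -> 'rV[R]_3) (u : R) v i :
  is_derive u 1 c v -> is_derive u 1 (fun t => c t ord0 i) (v ord0 i).
Proof.
move=> [dc <-]; rewrite derive_mx // mxE; apply: derivableP.
exact: (proj1 (derivable_mxP _ _ _) dc).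
Qed.

(** On the sphere this is the derivative of the constant squared norm; on the plane the last
    coordinate is constant. *)
Lemma tangent_dot_normal S (c : R -> 'rV[R]_3) (u : R) v :
  is_derive u 1 c v -> (\near u, on S (c u)) -> dot v (normal S (c u)) = 0.
Proof.
move=> dc; have dci i := is_derive_coord i dc; case: S => /= onS.
  pose f := (fun t => c t ord0 i0) ^+ 2 + (fun t => c t ord0 i1) ^+ 2 + (fun t => c t ord0 i2) ^+ 2.
  have fE t : f t = \sum_(i < 3) c t ord0 i ^+ 2 by rewrite sum3E /f !fctE.
  have h : is_derive u 1 f 0.
    apply: near_eq_is_derive (is_derive_cst (1 : R) u 1).
    by apply: filterS onS => t; rewrite fE => ->.
  have h' : is_derive u 1 f _ :=
    is_deriveD (is_deriveD (is_deriveX 2 (dci i0)) (is_deriveX 2 (dci i1))) (is_deriveX 2 (dci i2)).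
  have := @derive_val _ _ _ _ _ _ _ h; rewrite (@derive_val _ _ _ _ _ _ _ h').
  rewrite /dot sum3E /GRing.scale /= !expr1; lra.
have h : is_derive u 1 (fun t => c t ord0 ord_max) 0.
  apply: near_eq_is_derive (is_derive_cst (0 : R) u 1).
  by apply: filterS onS => t ->.
have v2 : v ord0 ord_max = 0.
  by have := @derive_val _ _ _ _ _ _ _ h; rewrite (@derive_val _ _ _ _ _ _ _ (dci ord_max)).
rewrite /dot sum3E !mxE /= !mulr0 !add0r mulr1 -v2.
by congr (v _ _); exact: val_inj.
Qed.

End Area.

(** * Derivatives along curves, and constancy of signs *)

Section Derive.
Context {R : realType}.

Lemma is_derive_diff_comp (U V : normedModType R) (c : R -> U) (f : U -> V) (u : R) v :
  is_derive u 1 c v -> differentiable f (c u) ->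
  is_derive u 1 (f \o c) ('d f (c u) v).
Proof.
move=> [dc <-] df; move/derivable1_diffP: (dc) => dc'.
have dfc : differentiable (f \o c) u by exact: differentiable_comp.
apply: DeriveDef; first exact/derivable1_diffP.
by rewrite !deriveE // diff_comp.
Qed.

Lemma is_derive_reparam (V : normedModType R) (c : R -> V) (r : R -> R) (u : R) a v :
  is_derive u 1 r a -> is_derive (r u) 1 c v -> is_derive u 1 (c \o r) (a *: v).
Proof.
move=> dr [dc <-]; move/derivable1_diffP: (dc) => dc'.
have := is_derive_diff_comp dr dc'; rewrite (deriv1E dc).
by rewrite derive1E.
Qed.

Lemma is_derive_pair (U V : normedModType R) (c : R -> U) (d : R -> V) (u : R) v w :
  is_derive u 1 c v -> is_derive u 1 d w ->
  is_derive u 1 (fun t => (c t, d t)) (v, w).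
Proof.
move=> [/derivable1_diffP dc <-] [/derivable1_diffP dd <-].
apply: DeriveDef; first by apply/derivable1_diffP; exact: differentiable_pair.
by rewrite !deriveE ?diff_pair //; exact: differentiable_pair.
Qed.

Lemma is_derive_unique (V : normedModType R) (c : R -> V) (u : R) v w :
  is_derive u 1 c v -> is_derive u 1 c w -> v = w.
Proof. by move=> [_ <-] [_ <-]. Qed.

Lemma is_derive_near_unique (V : normedModType R) (c d : R -> V) (u : R) v w :
  (\near u, c u = d u) -> is_derive u 1 c v -> is_derive u 1 d w -> v = w.
Proof. by move=> cd /(near_eq_is_derive cd); exact: is_derive_unique. Qed.

Lemma derive1_val (V : normedModType R) (c : R -> V) (u : R) v :
  is_derive u 1 c v -> derive1 c u = v.
Proof. by move=> [_ <-]; rewrite derive1E. Qed.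

Lemma curve_is_derive S (K : diagram R S) (u : R) :
  is_derive u 1 (curve K) (derive1 (curve K) u).
Proof.
have [/(_ u)/derivable1_diffP dK _] := curve_C1 K.
by rewrite derive1E; exact: derivableP.
Qed.

Lemma near_unit (u : R) : 0 < u < 1 -> \near u, 0 <= u <= 1.
Proof.
move=> u01; have : u \in `]0, 1[%R by rewrite in_itv.
by move/near_in_itv; apply: filterS => t; rewrite in_itv /= => /andP[/ltW -> /ltW ->].
Qed.

Lemma continuous_area (T : topologicalType) S (p v w : T -> 'rV[R]_3) :
  continuous p -> continuous v -> continuous w ->
  continuous (fun t => area S (p t) (v t) (w t)).
Proof.
have cc (f : T -> 'rV[R]_3) i : continuous f -> continuous (fun t => f t ord0 i).
  move=> cf t; apply: (@continuous_comp _ _ _ f (fun M : 'rV[R]_3 => M ord0 i)); first exact: cf.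
  exact: coord_continuous.
move=> cp cv cw.
have cn i : continuous (fun t => normal S (p t) ord0 i).
  by case: S => /=; [exact: cc | move=> t; exact: cvg_cst].
under eq_fun do rewrite areaE.
move=> t; apply: cvgD; first apply: cvgD.
- by apply: cvgM; [apply: cvgB; apply: cvgM; exact: cc | exact: cn].
- by apply: cvgM; [apply: cvgB; apply: cvgM; exact: cc | exact: cn].
- by apply: cvgM; [apply: cvgB; apply: cvgM; exact: cc | exact: cn].
Qed.

(** By the intermediate value theorem. It is applied to the time of an isotopy and to a segment in
    the plane of a chart. *)
Lemma ivt_same_sign (f : R -> R) : continuous f ->
  (forall s, 0 <= s <= 1 -> f s != 0) -> (0 < f 0) = (0 < f 1).
Proof.
move=> cf f0.
have H0 : f 0 != 0 by apply: f0; rewrite lexx ler01.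
have H1 : f 1 != 0 by apply: f0; rewrite lexx ler01.
have [] := pselect (Num.min (f 0) (f 1) <= 0 <= Num.max (f 0) (f 1)).
  move=> /(IVT ler01 (continuous_subspaceT cf))[s]; rewrite in_itv /= => /f0 + fs.
  by rewrite fs eqxx.
move: H0 H1; rewrite ge_min le_max !lt_def => -> -> /=.
case: (lerP 0 (f 0)) => a; case: (lerP 0 (f 1)) => b //= [].
  by rewrite (ltW b) orbT.
by rewrite (ltW a).
Qed.

End Derive.

(** * Isotopies and charts *)

Section Diagram.
Context {R : realType} {S : surface} (K : diagram R S).

Lemma double_sym (c : R -> 'rV[R]_3) (u v : R) : double c u v -> double c v u.
Proof. by move=> [u01 v01 /nesym uv /esym cuv]. Qed.

Lemma area_double_neq0 (u v : R) : double (curve K) u v ->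
  area S (curve K u) (derive1 (curve K) u) (derive1 (curve K) v) != 0.
Proof. by move=> /double_transversal/eqP. Qed.

End Diagram.

Section Isotopy.
Context {R : realType} {S : surface}.

(** The area of the two moved velocities depends continuously on time. It never vanishes, because
    the inverse diffeomorphism would carry a linear relation back to the velocities of [K], which
    are transversal. *)
Lemma isotopy_left_incoming (K K' : diagram R S) H (u v : R) :
  ambient_isotopy S H ->
  (forall u, 0 <= u <= 1 -> curve K' u = H 1 (curve K u)) ->
  double (curve K) u v -> left_incoming K' (u, v) = left_incoming K (u, v).
Proof.
move=> [[dH cH] H0 Hs] K'E uv.
have u01 := double_not_end uv; have v01 := double_not_end (double_sym uv).
have [u01' v01' _ cuv] := uv.
set HH := fun x : R^o * 'rV[R]_3 => H x.1 x.2 in dH cH.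
(* The velocity of the moved curve, written as a value of the differential of [HH] in a fixed
   direction, so that its continuity in [s] comes from [C1]. *)
pose W (s t : R) := 'd HH (s, curve K t) ((0, derive1 (curve K) t) : R^o * 'rV[R]_3).
have dW (s t : R) : is_derive t 1 (fun x => H s (curve K x)) (W s t).
  have dp : is_derive t 1 (fun x => (s, curve K x) : R^o * 'rV[R]_3) (0, derive1 (curve K) t).
    exact: (is_derive_pair (is_derive_cst (s : R^o) t 1) (curve_is_derive K t)).
  exact: is_derive_diff_comp dp (dH _).
have nearS (s t : R) : 0 <= s <= 1 -> 0 < t < 1 -> \near t, on S (H s (curve K t)).
  move=> /Hs[[_ onH] _] /near_unit; apply: filterS => x x01.
  exact/onH/curve_on.
pose f (s : R) := area S (H s (curve K u)) (W s u) (W s v).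
have cpair (p : 'rV[R]_3) : continuous (fun s => (s, p) : R^o * 'rV[R]_3).
  by move=> s; apply/differentiable_continuous; exact: differentiable_pair.
have cHs (t : R) : continuous (fun s => H s (curve K t)).
  move=> s; apply: (@continuous_comp _ _ _ (fun s => (s, curve K t) : R^o * 'rV[R]_3) HH).
    exact: cpair.
  exact/differentiable_continuous/dH.
have cW (t : R) : continuous (W^~ t).
  move=> s; apply: (@continuous_comp _ _ _ (fun s => (s, curve K t) : R^o * 'rV[R]_3)
    (fun x => 'd HH x ((0, derive1 (curve K) t) : R^o * 'rV[R]_3))).
    exact: cpair.
  exact: cH.
have f0 (s : R) : 0 <= s <= 1 -> f s != 0.
  move=> s01; have [[_ onH] [g [[dg _] _ gH _]]] := Hs _ s01.
  have Hc : H s (curve K u) = H s (curve K v) by rewrite cuv.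
  have gW (t : R) : 0 < t < 1 -> 'd g (H s (curve K t)) (W s t) = derive1 (curve K) t.
    move=> t01; have h := is_derive_diff_comp (dW s t) (dg _).
    apply: is_derive_near_unique h (curve_is_derive K t).
    by apply: filterS (near_unit t01) => x x01 /=; exact/gH/curve_on.
  apply/eqP => /area_dependent[].
  - exact/onH/curve_on.
  - exact: tangent_dot_normal (dW s u) (nearS _ _ s01 u01).
  - by rewrite Hc; exact: tangent_dot_normal (dW s v) (nearS _ _ s01 v01).
  move=> a [b [ab e]].
  (* Both strands are at the same point, so a single linear map brings both velocities back. *)
  have : 'd g (H s (curve K u)) (a *: W s u + b *: W s v) = 0 by rewrite e linear0.
  rewrite linearD !linearZ gW // Hc gW // => /(area_indep (area_double_neq0 uv))[a0 b0].
  by move: ab; rewrite a0 b0 eqxx => -[].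
have := @ivt_same_sign _ f (continuous_area (cHs u) (cW u) (cW v)) f0.
(* [H 0] is the identity on the surface only, but the curve stays there near an interior parameter,
   which is enough to identify derivatives. *)
have W0 (t : R) : 0 < t < 1 -> W 0 t = derive1 (curve K) t.
  move=> t01; apply: is_derive_near_unique (dW 0 t) (curve_is_derive K t).
  by apply: filterS (near_unit t01) => x x01 /=; exact/H0/curve_on.
have W1 (t : R) : 0 < t < 1 -> W 1 t = derive1 (curve K') t.
  move=> t01; apply: is_derive_near_unique (dW 1 t) (curve_is_derive K' t).
  by apply: filterS (near_unit t01) => x x01 /=; rewrite K'E.
rewrite /f !W0 // !W1 // H0 ?K'E; last exact: curve_on.
by rewrite /left_incoming /= K'E // => ->.
Qed.

End Isotopy.

Section Chart.
Context {R : realType} {S : surface} (phi : 'rV[R]_2 -> 'rV[R]_3).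
Hypothesis chart_phi : chart S phi.

Definition det2 (v w : 'rV[R]_2) : R := v ord0 ord0 * w ord0 ord_max - v ord0 ord_max * w ord0 ord0.

Definition jacobian_area (q : 'rV[R]_2) : R :=
  area S (phi q) ('d phi q (pt 1 0)) ('d phi q (pt 0 1)).

Lemma ptE (q : 'rV[R]_2) : q = q ord0 ord0 *: pt 1 0 + q ord0 ord_max *: pt 0 1.
Proof.
apply/rowP => -[[|[|//]] k]; rewrite !mxE /= ?mulr1 ?mulr0 ?addr0 ?add0r;
  by congr (q _ _); exact: val_inj.
Qed.

Lemma chart_area q v w :
  area S (phi q) ('d phi q v) ('d phi q w) = det2 v w * jacobian_area q.
Proof. by rewrite [v in LHS]ptE [w in LHS]ptE !linearD !linearZ area_comb. Qed.

(** The vector is the velocity of the image of the line through [q] in direction [v], a curve on the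
    surface. *)
Lemma chart_tangent q v : dot ('d phi q v) (normal S (phi q)) = 0.
Proof.
have [[dphi _] onphi _ _] := chart_phi.
have dl : is_derive (0 : R) 1 (fun t : R => q + t *: v) v.
  have dk : is_diff (0 : R) ( *:%R^~ v) ( *:%R^~ v) by exact: is_diff_scalel.
  have dk1 : is_derive (0 : R) 1 ( *:%R^~ v) v.
    apply: DeriveDef; first exact/derivable1_diffP.
    by rewrite deriveE // diff_val scale1r.
  by have := is_deriveD (is_derive_cst q (0 : R) 1) dk1; rewrite add0r.
have h : is_derive (0 : R) 1 (phi \o (fun t : R => q + t *: v)) ('d phi q v).
  by have := is_derive_diff_comp dl (dphi _); rewrite scale0r addr0.
by have := tangent_dot_normal h; rewrite /= scale0r addr0; apply; near do exact: onphi.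
Unshelve. all: by end_near. Qed.

Lemma jacobian_area_neq0 q : jacobian_area q != 0.
Proof.
have [_ onphi _ imm] := chart_phi.
apply/eqP => /area_dependent[|||a [b [ab e]]]; try exact: chart_tangent; first exact: onphi.
have /imm /rowP h : 'd phi q (a *: pt 1 0 + b *: pt 0 1) = 0 by rewrite linearD !linearZ.
have := h ord0; have := h ord_max; rewrite !mxE /= => h1 h0.
have a0 : a = 0 by lra.
have b0 : b = 0 by lra.
by move: ab; rewrite a0 b0 eqxx => -[].
Qed.

(** The plane is connected: the Jacobian has no zero on the segment from [q] to [q']. The
    orientation of the chart can thus be read at any point, later at 0. *)
Lemma jacobian_area_same_sign q q' : (0 < jacobian_area q) = (0 < jacobian_area q').
Proof.
have [[dphi cphi] _ _ _] := chart_phi.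
pose l (t : R) := q + t *: (q' - q).
have cl : continuous l.
  move=> t; apply: cvgD; first exact: cvg_cst.
  by apply: cvgZ; [exact: cvg_id | exact: cvg_cst].
have l0 : l 0 = q by rewrite /l scale0r addr0.
have l1 : l 1 = q' by rewrite /l scale1r addrC subrK.
suff : (0 < jacobian_area (l 0)) = (0 < jacobian_area (l 1)) by rewrite l0 l1.
apply: (@ivt_same_sign _ (fun t => jacobian_area (l t))); last first.
  by move=> s _; exact: jacobian_area_neq0.
apply: continuous_area => t.
- apply: (@continuous_comp _ _ _ l phi); first exact: cl.
  exact/differentiable_continuous/dphi.
- by apply: (@continuous_comp _ _ _ l (fun q => 'd phi q (pt 1 0))); [exact: cl | exact: cphi].
- by apply: (@continuous_comp _ _ _ l (fun q => 'd phi q (pt 0 1))); [exact: cl | exact: cphi].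
Qed.

End Chart.

(** * Labels and weights *)

Section Crossings.
Context {R : realType} {S : surface} (K : diagram R S).

(* [f w e] is the term of a crossing of weight [w] and sign [e]; for invariance
   only [f 0 e = 0] and [f w (- e) = - f w e] matter. *)
Definition crossing_sum (V : zmodType) (f : int -> int -> V) : V :=
  \sum_(c \in crossing K) f (weight K c) (sgn K c).

Lemma flat_pair_finite (A : set (R * R)) : finite_set (flat_pair K `&` A).
Proof. by apply: sub_finite_set (double_finite K) => p [[]]. Qed.

Lemma crossing_flat c : crossing K c -> flat_pair K c.
Proof. by move=> [dc tc]; split=> //; rewrite tc. Qed.

Lemma crossing_flatE : crossing K = flat_pair K `&` [set c | tag K c.1 = Over].
Proof.
apply/seteqP; split=> c; last by move=> [[dc _] tc].
by move=> cc; split; [exact: crossing_flat | case: cc].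
Qed.

Lemma flat_pair_sym u v : flat_pair K (u, v) -> flat_pair K (v, u).
Proof.
move=> [/= uv tu]; split=> /=; first exact: double_sym.
by move: (tag_matching uv) tu; case: (tag K u); case: (tag K v).
Qed.

Lemma left_incomingC u v : double (curve K) u v ->
  left_incoming K (v, u) = ~~ left_incoming K (u, v).
Proof.
move=> uv; have A0 := area_double_neq0 uv; have [_ _ _ cuv] := uv.
by rewrite /left_incoming /= -cuv areaC oppr_gt0 -leNgt le_eqVlt (negbTE A0).
Qed.

Lemma label_changeC u v : double (curve K) u v ->
  label_change K (v, u) = - label_change K (u, v).
Proof.
by move=> /left_incomingC; rewrite /label_change => ->; case: left_incoming; rewrite ?opprK.
Qed.

Lemma sgnE c : sgn K c = - label_change K c.
Proof. by rewrite /sgn /label_change /positive; case: ifP; rewrite ?opprK. Qed.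

Lemma weightE c : weight K c = label K c.1 - label K c.2 + label_change K c.
Proof.
rewrite /weight /positive /label_change /w_plus /w_minus /label_left /label_right.
by case: (left_incoming K c); ring.
Qed.

End Crossings.

Lemma weight_sgn_eq (R : realType) (S : surface) (K K' : diagram R S) c c' :
  label K c.1 = label K' c'.1 -> label K c.2 = label K' c'.2 ->
  label_change K c = label_change K' c' ->
  weight K c = weight K' c' /\ sgn K c = sgn K' c'.
Proof. by move=> l1 l2 e; rewrite !weightE !sgnE l1 l2 e. Qed.

Lemma reindex_sum (V : nmodType) (T : choiceType) (P Q : set T) (F G : T -> V) (h : T -> T) :
  set_bij P Q h -> (forall x, P x -> F (h x) = G x) ->
  \sum_(x \in Q) F x = \sum_(x \in P) G x.
Proof.
move=> bh FG; rewrite (reindex_fsbig h P) //; apply: eq_fsbigr => x.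
by rewrite inE; exact: FG.
Qed.

Section Reindex.
Context {R : realType} {S : surface} (K K' : diagram R S) (r : R -> R).
Hypothesis flat_r : forall p, flat_pair K' p -> flat_pair K (r p.1, r p.2).
Hypothesis flat_surj : forall q, flat_pair K q ->
  exists2 p, flat_pair K' p & q = (r p.1, r p.2).
Hypothesis flat_mono : forall p q, flat_pair K' p -> flat_pair K' q ->
  (r p.1 < r q.1) = (p.1 < q.1).
Hypothesis flat_left : forall p, flat_pair K' p ->
  left_incoming K (r p.1, r p.2) = left_incoming K' p.
Hypothesis flat_tag : forall p, flat_pair K' p -> tag K (r p.1) = tag K' p.1.

Let rr (p : R * R) := (r p.1, r p.2).

Lemma flat_inj : set_inj (flat_pair K') rr.
Proof.
have inj1 p q : flat_pair K' p -> flat_pair K' q -> r p.1 = r q.1 -> p.1 = q.1.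
  move=> fp fq e; apply/eqP; rewrite eq_le !leNgt -!flat_mono // e ltxx.
  by [].
move=> [u v] [u' v']; rewrite !inE => fp fq [e1 e2].
congr pair; first exact: (inj1 (u, v) (u', v')).
by apply: (inj1 (v, u) (v', u')) => //; exact: flat_pair_sym.
Qed.

Lemma reindex_label p : flat_pair K' p -> label K (r p.1) = label K' p.1.
Proof.
move=> fp; apply: (reindex_sum (h := rr)) => [|q [fq _]]; last first.
  by rewrite /label_change flat_left.
split.
- by move=> q [fq qp]; split; [exact: flat_r | rewrite /= flat_mono].
- by apply: sub_in2 flat_inj => q; rewrite !inE => -[].
- move=> q [/flat_surj[q' fq' ->]] /=; rewrite flat_mono // => q'p.
  by exists q'.
Qed.

Lemma reindex_crossing_sum (V : zmodType) (f : int -> int -> V) :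
  crossing_sum K f = crossing_sum K' f.
Proof.
apply: (reindex_sum (h := rr)) => [|c cc].
  split.
  - move=> c cc; have fc := crossing_flat cc; have [dc _] := flat_r fc.
    by split=> //=; rewrite flat_tag //; case: cc.
  - by apply: sub_in2 flat_inj => q; rewrite !inE; exact: crossing_flat.
  - move=> c cc; have [c' fc' E] := flat_surj (crossing_flat cc).
    exists c' => //; case: fc' (fc') => dc' _ fc'; split=> //.
    by rewrite -flat_tag //; case: cc; rewrite E.
have fc := crossing_flat cc.
have [|||-> ->] // := @weight_sgn_eq _ _ K K' (rr c) c.
- exact: reindex_label.
(* [reindex_label] speaks of first components; the second pass of [c] is the first of the reversed
   pair. *)
- by apply: (@reindex_label (c.2, c.1)); apply: flat_pair_sym; case: c fc {cc}.
- by rewrite /label_change flat_left.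
Qed.

End Reindex.

(** * Splitting labels and crossing sums along disjoint intervals of parameters *)

Section Blocks.
Context {R : realType} {n : nat} (B : 'I_n -> set R).
Hypothesis block_convex : forall i u v w, B i u -> B i v -> u <= w <= v -> B i w.
Hypothesis block_disjoint : forall i j u, B i u -> B j u -> i = j.

Definition blocks : set R := [set u | exists i, B i u].

Lemma fsbig_blocks (V : nmodType) (A : set (R * R)) (F : R * R -> V) : finite_set A ->
  \sum_(p \in A) F p =
    \sum_(p \in A `&` [set p | ~ blocks p.1]) F p +
    \sum_i \sum_(p \in A `&` [set p | B i p.1]) F p.
Proof.
move=> fA; rewrite (fsbigID [set p | ~ blocks p.1] A) //; congr (_ + _).
have fA' : finite_set (A `&` ~` [set p | ~ blocks p.1]) by exact: finite_setIl.
(* By disjointness exactly one index contributes to each remaining pair, so the sum over the blocks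
   can be inserted and then exchanged with the outer one. *)
transitivity (\sum_(p \in A `&` ~` [set p | ~ blocks p.1])
    \sum_i (if p \in [set p | B i p.1] then F p else 0)).
  apply: eq_fsbigr => p; rewrite inE => -[_ /contrapT[i Bi]].
  rewrite (bigD1 i) //= mem_set // big1 ?addr0 // => j ji.
  by rewrite memNset // => Bj; move/eqP: ji; apply; exact: block_disjoint Bj Bi.
rewrite fsbig_finite // exchange_big /=; apply: eq_bigr => i _.
rewrite -fsbig_finite // -fsbig_mkcondr; apply: eq_fsbigl.
apply/seteqP; split=> p /= => [[[Ap _] Bi]|[Ap Bi]] //; split=> //; split=> //; apply.
by exists i.
Qed.

Context {S : surface}.
Implicit Types K : diagram R S.

Definition block_label K i u : int :=
  \sum_(p \in flat_pair K `&` [set p | B i p.1] `&` [set p | p.1 < u]) label_change K p.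

Definition block_total K i : int :=
  \sum_(p \in flat_pair K `&` [set p | B i p.1]) label_change K p.

Definition outer_label K u : int :=
  \sum_(p \in flat_pair K `&` [set p | ~ blocks p.1] `&` [set p | p.1 < u]) label_change K p.

Lemma label_blocks K u : label K u = outer_label K u + \sum_i block_label K i u.
Proof.
rewrite /label fsbig_blocks; last exact: flat_pair_finite.
congr (_ + _); last apply: eq_bigr => i _; apply: eq_fsbigl; rewrite setIAC //.
Qed.

(** One point of the block before [u] suffices: a point of the block after [u] would put [u] itself
    in the block, by convexity. *)
Lemma block_label_before K i u w : ~ B i u -> B i w -> w < u ->
  block_label K i u = block_total K i.
Proof.
move=> Bu Bw wu; apply: eq_fsbigl; apply/seteqP; split=> p /= => [[]//|[fp Bp]].
split=> //; rewrite ltNge; apply/negP => up; apply: Bu.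
by apply: (block_convex Bw Bp); rewrite (ltW wu).
Qed.

Lemma block_label_after K i u : (forall w, B i w -> ~ w < u) -> block_label K i u = 0.
Proof.
by move=> Bu; apply: fsbig1 => p [[_ /= /Bu]].
Qed.

Section Replacement.
Variables K K' : diagram R S.
Hypothesis flat_blocks : forall p, flat_pair K p -> blocks p.1 -> blocks p.2.
Hypothesis flat_outer : forall p, ~ blocks p.1 -> flat_pair K p <-> flat_pair K' p.
Hypothesis left_outer : forall p, ~ blocks p.1 -> flat_pair K p ->
  left_incoming K' p = left_incoming K p.
Hypothesis tag_outer : forall p, ~ blocks p.1 -> flat_pair K p -> tag K' p.1 = tag K p.1.
Hypothesis same_total : forall i, block_total K i = block_total K' i.

(** Two distinct parameters are allowed because a move shifts passes within a block, while no
    outside parameter separates two points of one block. *)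
Lemma same_outer_label u v :
  (forall w, ~ blocks w -> (w < u) = (w < v)) -> outer_label K u = outer_label K' v.
Proof.
move=> uv; rewrite /outer_label.
have -> : flat_pair K `&` [set p | ~ blocks p.1] `&` [set p | p.1 < u] =
          flat_pair K' `&` [set p | ~ blocks p.1] `&` [set p | p.1 < v].
  by apply/seteqP; split=> p /= [[/flat_outer + np]]; rewrite ?uv // => fp pv;
    do 2?split=> //; exact: fp.
apply: eq_fsbigr => p; rewrite inE => -[[fp np] _].
by rewrite /label_change left_outer //; apply/flat_outer.
Qed.

Lemma same_block_label i u v : ~ B i u -> ~ B i v ->
  (forall w, B i w -> (w < u) = (w < v)) -> block_label K i u = block_label K' i v.
Proof.
move=> Bu Bv uv.
have [[w Bw wu]|no] := pselect (exists2 w, B i w & w < u).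
  rewrite (block_label_before K Bu Bw wu) (block_label_before K' Bv Bw) ?same_total //.
  by rewrite -uv.
by rewrite !block_label_after // => w Bw; [rewrite -uv // | ] => wu; apply: no; exists w.
Qed.

Lemma label_outside u : ~ blocks u -> label K u = label K' u.
Proof.
move=> nu; rewrite (label_blocks K) (label_blocks K') (same_outer_label (v := u)) //.
by congr (_ + _); apply: eq_bigr => i _; apply: same_block_label => // Bu; apply: nu; exists i.
Qed.

Lemma block_lt k u v w : B k u -> B k v -> ~ B k w -> (w < u) = (w < v).
Proof.
wlog suff wl : u v / B k u -> B k v -> ~ B k w -> w < u -> w < v.
  by move=> Bu Bv Bw; apply/idP/idP; exact: wl.
move=> Bu Bv Bw wu; rewrite ltNge; apply/negP => vw; apply: Bw.
by apply: (block_convex Bv Bu); rewrite vw ltW.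
Qed.

(** By convexity of block [k], every outside parameter and every other block is on the same side of
    [u] and of [v]. Other blocks are met entirely or not at all, so equal totals suffice there; only
    the part of block [k] already run through can differ. *)
Lemma label_inside k u v : B k u -> B k v ->
  label K u - block_label K k u = label K' v - block_label K' k v.
Proof.
move=> Bu Bv.
have D1 L w : label L w - block_label L k w = outer_label L w + \sum_(i | i != k) block_label L i w.
  by rewrite label_blocks (bigD1 k) //=; ring.
rewrite (D1 K) (D1 K') (same_outer_label (v := v)); last first.
  by move=> w nw; apply: (block_lt Bu Bv) => Bw; apply: nw; exists k.
congr (_ + _); apply: eq_bigr.
have nB i w : i != k -> B k w -> ~ B i w.
  by move=> /eqP ik Bk Bi; apply: ik; exact: block_disjoint Bi Bk.
move=> i ik; apply: same_block_label; [exact: nB Bu | exact: nB Bv |].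
by move=> w Bw; apply: (block_lt Bu Bv) => Bw'; exact: nB ik Bw' Bw.
Qed.

Definition inner_sum (V : zmodType) (f : int -> int -> V) (L : diagram R S) i : V :=
  \sum_(c \in crossing L `&` [set c | B i c.1]) f (weight L c) (sgn L c).

Lemma replacement_crossing_sum (V : zmodType) (f : int -> int -> V) :
  \sum_i inner_sum f K i = \sum_i inner_sum f K' i ->
  crossing_sum K f = crossing_sum K' f.
Proof.
move=> inner.
have split_sum (L : diagram R S) : crossing_sum L f =
    \sum_(c \in crossing L `&` [set c | ~ blocks c.1]) f (weight L c) (sgn L c) +
    \sum_i inner_sum f L i.
  by apply: fsbig_blocks; rewrite crossing_flatE; exact: flat_pair_finite.
rewrite (split_sum K) (split_sum K') inner; congr (_ + _).
have cE : crossing K `&` [set p | ~ blocks p.1] = crossing K' `&` [set p | ~ blocks p.1].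
  rewrite !crossing_flatE; apply/seteqP; split=> c /= [[fc tc] nc].
    by split=> //; split; [exact/flat_outer | rewrite tag_outer].
  have fc' : flat_pair K c by exact/flat_outer.
  by split=> //; split=> //; rewrite -tag_outer.
rewrite -cE; apply: eq_fsbigr => c; rewrite inE => -[/crossing_flat fc nc].
have fc' : flat_pair K' c by exact/flat_outer.
(* The weight also uses the label at the under-pass, so that pass has to be outside as well. *)
have nc2 : ~ blocks c.2.
  move=> c2; apply: nc; apply: (flat_blocks (p := (c.2, c.1))) c2.
  by apply: flat_pair_sym; case: (c) fc.
have [|||-> ->] // := @weight_sgn_eq _ _ K K' c c; [exact: label_outside .. |].
by rewrite /label_change left_outer.
Qed.

End Replacement.
End Blocks.

(** * Moves that preserve the flat crossings *)

Lemma near_outside (R : realType) (a b u : R) :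
  ~ a <= u <= b -> \near u, ~ a <= u <= b.
Proof.
move=> nu; have [ua|au] := ltP u a.
  by apply: filterS (lt_nbhsl ua) => x xa; rewrite leNgt xa.
have [bu|ub] := ltP b u; last by exfalso; apply: nu; rewrite au.
by apply: filterS (lt_nbhsr bu) => x bx; rewrite [x <= b]leNgt bx andbF.
Qed.

Section Global.
Context {R : realType} {S : surface} {V : zmodType}.
Variable f : int -> int -> V.
Implicit Types K : diagram R S.

Lemma same_flat_crossing_sum K K' : flat_pair K = flat_pair K' ->
  (forall p, flat_pair K p -> left_incoming K p = left_incoming K' p) ->
  (forall p, flat_pair K p -> tag K p.1 = tag K' p.1) ->
  crossing_sum K f = crossing_sum K' f.
Proof.
move=> fKK' lKK' tKK'; apply: (@reindex_crossing_sum _ _ _ _ id) => //=.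
- by move=> [u v]; rewrite -fKK'.
- by move=> q fq; exists q; [rewrite -fKK' | case: q fq].
- by move=> [u v]; rewrite -fKK'; exact: lKK'.
- by move=> p; rewrite -fKK'; exact: tKK'.
Qed.

Lemma isotopic_crossing_sum K K' : isotopic K K' -> crossing_sum K f = crossing_sum K' f.
Proof.
move=> [H isoH [K'E tKK']].
have [_ _ Hs] := isoH.
have [|[_ onH] [g [_ _ gH _]]] := Hs 1; first by rewrite lexx ler01.
have injH p q : on S p -> on S q -> H 1 p = H 1 q -> p = q.
  by move=> onp onq e; rewrite -(gH p onp) -(gH q onq) e.
have dE (u v : R) : double (curve K) u v <-> double (curve K') u v.
  split=> -[u01 v01 uv e]; split=> //; first by rewrite !K'E // e.
  by apply: injH; rewrite -?K'E //; exact: curve_on.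
apply: same_flat_crossing_sum.
- by apply/seteqP; split=> -[u v] [/= d t]; split=> /=; try exact/dE;
    move: t; rewrite (tKK' u v) //; exact/dE.
- by move=> [u v] [d _]; symmetry; exact: isotopy_left_incoming isoH K'E d.
- by move=> [u v] [/tKK' ->].
Qed.

Lemma left_incoming_scale K K' (p q : R * R) a b : 0 < a -> 0 < b ->
  curve K' p.1 = curve K q.1 ->
  derive1 (curve K') p.1 = a *: derive1 (curve K) q.1 ->
  derive1 (curve K') p.2 = b *: derive1 (curve K) q.2 ->
  left_incoming K' p = left_incoming K q.
Proof.
by move=> a0 b0 e d1 d2; rewrite /left_incoming e d1 d2 areaZ pmulr_rgt0 // mulr_gt0.
Qed.

(** Common form of reparametrizations and [Omega_v]: [K'] runs increasingly along a part of [K] that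
    contains all flat passes. Velocities are rescaled by positive factors, which preserve the sign
    of the area. *)
Lemma subcurve_crossing_sum K K' (r dr : R -> R) :
  (forall u : R, 0 <= u <= 1 -> 0 <= r u <= 1) ->
  (forall u v : R, 0 <= u <= 1 -> 0 <= v <= 1 -> u < v -> r u < r v) ->
  (forall u : R, 0 < u < 1 -> is_derive u 1 r (dr u) /\ 0 < dr u) ->
  (forall u : R, 0 <= u <= 1 -> curve K' u = curve K (r u)) ->
  (forall u v, double (curve K') u v -> tag K' u = tag K (r u)) ->
  (forall p, flat_pair K p -> exists2 u : R, 0 <= u <= 1 & p.1 = r u) ->
  crossing_sum K f = crossing_sum K' f.
Proof.
move=> r01 rmono rder K'E tE rsurj.
have rlt (u v : R) : 0 <= u <= 1 -> 0 <= v <= 1 -> (r u < r v) = (u < v).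
  move=> u01 v01; have [uv|vu|->] := ltgtP u v; last by rewrite ltxx.
    exact: rmono.
  by apply/negbTE; rewrite -leNgt ltW // rmono.
have rneq (u v : R) : 0 <= u <= 1 -> 0 <= v <= 1 -> u <> v -> r u <> r v.
  move=> u01 v01 + e; have [uv|vu|//] := ltgtP u v.
    by have := rmono _ _ u01 v01 uv; rewrite e ltxx.
  by have := rmono _ _ v01 u01 vu; rewrite e ltxx.
have rd (u : R) : 0 < u < 1 -> derive1 (curve K') u = dr u *: derive1 (curve K) (r u).
  move=> u01; have [du _] := rder _ u01.
  apply: derive1_val; apply: near_eq_is_derive (is_derive_reparam du (curve_is_derive K _)).
  by apply: filterS (near_unit u01) => x x01 /=; rewrite K'E.
have dE (u v : R) : double (curve K') u v -> double (curve K) (r u) (r v).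
  by move=> [u01 v01 uv e]; split; [exact: r01 | exact: r01 | exact: rneq | rewrite -!K'E].
apply: (@reindex_crossing_sum _ _ _ _ r).
- by move=> [u v] [/= d t]; split; [exact: dE | rewrite /= -(tE _ _ d)].
- move=> [u v] fuv; have [/= d t] := fuv.
  have [u' u01 /= uE] := rsurj _ fuv; have [v' v01 /= vE] := rsurj _ (flat_pair_sym fuv).
  exists (u', v'); last by rewrite uE vE.
  have d' : double (curve K') u' v'.
    have [_ _ uv e] := d; split=> //; first by move=> e'; apply: uv; rewrite uE vE e'.
    by rewrite !K'E // -uE -vE.
  by split=> //=; rewrite (tE _ _ d') -uE.
- by move=> [u v] [u' v'] [[/= u01 _ _ _] _] [[/= u01' _ _ _] _]; exact: rlt.
- move=> [u v] [/= d _]; have [u01 v01 _ _] := d.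
  have iu := double_not_end d; have iv := double_not_end (double_sym d).
  symmetry; apply: (@left_incoming_scale _ _ _ _ (dr u) (dr v)) => /=; rewrite ?rd ?K'E //.
    by have [] := rder _ iu.
  by have [] := rder _ iv.
- by move=> [u v] [/= /tE ->].
Qed.

Lemma reparametrized_crossing_sum K K' : reparametrized K K' ->
  crossing_sum K f = crossing_sum K' f.
Proof.
move=> [r [[dr _] [r0 r1] rpos K'E tE]].
have der (u : R) : is_derive u 1 r (derive1 r u).
  by rewrite derive1E; apply: derivableP; exact/derivable1_diffP.
have cr : continuous r by move=> u; exact/differentiable_continuous/dr.
have rmono (u v : R) : 0 <= u <= 1 -> 0 <= v <= 1 -> u < v -> r u < r v.
  move=> u01 v01; have dr' x : x \in `]0, 1[%R -> derivable r x 1 by have [] := der x.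
  have rpos' (x : R) : x \in `]0, 1[%R -> 0 < derive1 r x.
    by rewrite in_itv /= => /andP[/ltW x0 /ltW x1]; apply: rpos; rewrite x0.
  by apply: (gtr0_derive1_lt_cc dr' rpos' (continuous_subspaceT cr)); rewrite in_itv.
have r01 (u : R) : 0 <= u <= 1 -> 0 <= r u <= 1.
  move=> /[dup] u01 /andP[u0 u1]; apply/andP; split.
    move: u0; rewrite le_eqVlt => /predU1P[<-|u0]; first by rewrite r0.
    by rewrite -r0 ltW // rmono // lexx ler01.
  move: u1; rewrite le_eqVlt => /predU1P[->|u1]; first by rewrite r1.
  by rewrite -r1 ltW // rmono // lexx ler01.
apply: (@subcurve_crossing_sum _ _ r (derive1 r)) => //.
  by move=> u u01; split; [exact: der | apply: rpos; rewrite !ltW; case/andP: u01].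
move=> [u v] [[/= u01 _ _ _] _].
have [||w] := @IVT _ r 0 1 u ler01.
- exact: continuous_subspaceT.
- by rewrite r0 r1 min_l ?max_r ?ler01.
by rewrite in_itv /= => w01 <-; exists w.
Qed.

Lemma Omega_v_crossing_sum K K' : Omega_v K K' -> crossing_sum K f = crossing_sum K' f.
Proof.
move=> [a [b [[a0 ab b1] vir K'E tE]]].
apply: (@subcurve_crossing_sum _ _ (fun u => a + (b - a) * u) (fun => b - a)) => //.
- by move=> u /andP[u0 u1]; apply/andP; split; nra.
- by move=> u v _ _ uv; rewrite ltrD2l ltr_pM2l // subr_gt0.
- move=> u _; split; last by rewrite subr_gt0.
  have h := is_deriveD (is_derive_cst a u 1) (is_deriveM (is_derive_cst (b - a) u 1) (is_derive_id u 1)).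
  by apply: is_derive_eq h _; rewrite /GRing.scale /=; ring.
- move=> [u v] [/= d t].
  (* The pieces cut off carry virtual crossings only, so a flat pass lies on the remaining part. *)
  have /andP[au ub] : a <= u <= b.
    by apply: contrapT => nu; apply: t; exact: vir nu d.
  have ba : b - a != 0 by rewrite subr_eq0 gt_eqF.
  exists ((u - a) / (b - a)); last by rewrite mulrC divfK // addrC subrK.
  by rewrite divr_ge0 ?ler_pdivrMr ?mul1r ?lerD2r ?subr_ge0 ?subr_gt0 // ltW.
Qed.

(** No flat pass lies over [a,b]. Its complement is open, so the two curves agree near each flat
    pass and have the same velocity there. *)
Lemma detour_crossing_sum K K' : detour K K' -> crossing_sum K f = crossing_sum K' f.
Proof.
move=> [a [b [[a0 ab b1] [vK vK'] K'E tE]]].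
have flat_out (L : diagram R S) (u v : R) : virtual_on L [set u | a <= u <= b] -> flat_pair L (u, v) -> ~ a <= u <= b.
  by move=> vL [/= d t] h; apply: t; exact: vL h d.
have eqc (u : R) : 0 <= u <= 1 -> ~ a <= u <= b -> curve K' u = curve K u.
  by move=> u01 nu; apply: K'E => // /andP[/ltW au /ltW ub]; apply: nu; rewrite au.
have deq (u : R) : 0 < u < 1 -> ~ a <= u <= b -> derive1 (curve K') u = derive1 (curve K) u.
  move=> u01 nu; apply: derive1_val; apply: near_eq_is_derive (curve_is_derive K u).
  by apply: filterS2 (near_unit u01) (near_outside nu) => x x01 nx; rewrite eqc.
have fE : flat_pair K = flat_pair K'.
  apply/seteqP; split=> -[u v] fuv; have fvu := flat_pair_sym fuv; have [/= d t] := fuv.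
    have nu := flat_out _ _ _ vK fuv; have nv := flat_out _ _ _ vK fvu.
    have [u01 v01 uv e] := d.
    by split=> /=; [split=> //; rewrite !eqc | rewrite (tE u v)].
  have nu := flat_out _ _ _ vK' fuv; have nv := flat_out _ _ _ vK' fvu.
  have [u01 v01 uv e] := d.
  have d' : double (curve K) u v by split=> //; rewrite -!eqc.
  by split=> //=; rewrite -(tE u v).
apply: same_flat_crossing_sum => //.
  move=> [u v] fuv; have fvu := flat_pair_sym fuv; have [/= d t] := fuv.
  have nu := flat_out _ _ _ vK fuv; have nv := flat_out _ _ _ vK fvu.
  have [u01 v01 uv e] := d.
  have iu := double_not_end d; have iv := double_not_end (double_sym d).
  symmetry; apply: (@left_incoming_scale _ _ _ _ 1 1) => //=; rewrite ?scale1r.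
  - exact: eqc.
  - exact: deq.
  - exact: deq.
move=> [u v] fuv; have fvu := flat_pair_sym fuv; have [/= d t] := fuv.
by rewrite (tE u v) //; [exact: flat_out fuv | exact: flat_out fvu].
Qed.

End Global.

(** * Replacing a picture in a disk *)

Lemma fsbig_list (V : nmodType) (T : choiceType) (A P : set T) (r : seq T) (F : T -> V) :
  uniq r -> A = [set` r] ->
  \sum_(x \in A `&` P) F x = \sum_(x <- r | `[< P x >]) F x.
Proof.
move=> ur ->; rewrite -[RHS]big_filter [RHS]fsbig_seq ?filter_uniq //.
apply: eq_fsbigl; apply/seteqP; split=> x /=; rewrite mem_filter.
  by move=> [-> Px]; rewrite andbT; exact/asboolP.
by move=> /andP[/asboolP Px ->].
Qed.

Lemma mulr_gt0_addb (R : realDomainType) (a b : R) : a != 0 -> b != 0 ->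
  (0 < a * b) = ((0 < a) == (0 < b)).
Proof.
move=> a0 b0; have [ap|an|e] := ltgtP a 0; last by rewrite e eqxx in a0.
  by rewrite nmulr_rgt0 // lt_neqAle b0 leNgt; case: (0 < b).
by rewrite pmulr_rgt0 //; case: (0 < b).
Qed.

Section Strands.
Context {R : realType} {n : nat} (m d : 'I_n -> R).
Hypothesis d0 : forall i, d i <> 0.
Hypothesis strand_disjoint : forall i j x y, -1 <= x <= 1 -> -1 <= y <= 1 -> i != j ->
  m i + d i * x <> m j + d j * y.

Definition block (i : 'I_n) : set R := [set u | exists2 x, -1 <= x <= 1 & u = m i + d i * x].

Lemma block_convex i u v w : block i u -> block i v -> u <= w <= v -> block i w.
Proof.
move=> [x /andP[x0 x1] ->] [y /andP[y0 y1] ->] /andP[xw wy].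
have di : d i != 0 by apply/eqP.
have [z wE] : exists z, w = m i + d i * z by exists ((w - m i) / d i); field.
exists z => //; move: xw wy; rewrite wE !lerD2l.
have [dp|dn|e] := ltgtP (d i) 0; last by rewrite e eqxx in di.
  by rewrite !ler_nM2l // => zx yz; rewrite (le_trans y0) // (le_trans zx).
by rewrite !ler_pM2l // => xz zy; rewrite (le_trans x0) // (le_trans zy).
Qed.

Lemma block_disjoint i j u : block i u -> block j u -> i = j.
Proof.
move=> [x x1 ->] [y y1 /(strand_disjoint x1 y1) e]; apply/eqP; apply/negPn/negP.
exact: e.
Qed.

Lemma block_strand i x : -1 <= x <= 1 -> block i (m i + d i * x).
Proof. by exists x. Qed.

Lemma strand_inj i x y : m i + d i * x = m i + d i * y -> x = y.
Proof. by move=> /addrI; apply: mulfI; apply/eqP. Qed.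

Lemma blocks_inside u : blocks block u <-> inside m d u.
Proof.
split=> [[i [x x1 ->]]|[i [x [x1 ->]]]]; first by exists i, x.
by exists i, x.
Qed.

Definition at_pair (i : 'I_n) (c : R * ('I_n * R)) : R * R :=
  (m i + d i * c.1, m c.2.1 + d c.2.1 * c.2.2).

(** The bounds on the times are what makes the strand recoverable from the parameter: the strands
    have disjoint parameters over [-1,1] only. *)
Lemma at_pair_inj i : {in [pred c | (-1 <= c.1 <= 1) && (-1 <= c.2.2 <= 1)] &, injective (at_pair i)}.
Proof.
move=> [x [j y]] [x' [j' y']] /andP[/= x1 y1] /andP[/= x1' y1'] [/strand_inj -> e].
have ej : j = j' by apply: (@block_disjoint _ _ (m j + d j * y)); [exists y | rewrite e; exists y'].
by move: e; rewrite -ej => /strand_inj ->.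
Qed.

End Strands.

(* [v i] is the velocity of the strand [s i]; [(x, (j, y)) \in cr i] lists the
   passes of strand [i], at time [x], through its crossings with strand [j] at
   time [y]. *)
Record picture (R : realType) (n : nat) (s v : 'I_n -> R -> 'rV[R]_2)
    (cr : 'I_n -> seq (R * ('I_n * R))) : Prop := Picture {
  picture_square : forall i x, -1 <= x <= 1 -> in_square (s i x);
  picture_derive : forall i (x : R), is_derive x 1 (s i) (v i x);
  picture_uniq : forall i, uniq (cr i);
  picture_interior : forall i c, c \in cr i -> -1 < c.1 < 1 /\ -1 < c.2.2 < 1;
  picture_crossings : forall i x j y, -1 <= x <= 1 -> -1 <= y <= 1 ->
    (x, (j, y)) \in cr i <-> s i x = s j y /\ (i, x) <> (j, y)
}.

(** * A diagram that draws a picture in a disk *)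

Section Drawing.
Context {R : realType} {S : surface} {n : nat}.
Variables (m d : 'I_n -> R) (phi : 'rV[R]_2 -> 'rV[R]_3) (h : 'I_n -> nat).
Variables (s v : 'I_n -> R -> 'rV[R]_2) (cr : 'I_n -> seq (R * ('I_n * R))).
Variable K : diagram R S.
Hypothesis chart_phi : chart S phi.
Hypothesis d0 : forall i, d i <> 0.
Hypothesis strand_unit : forall i x, -1 <= x <= 1 -> 0 < m i + d i * x < 1.
Hypothesis strand_disjoint : forall i j x y, -1 <= x <= 1 -> -1 <= y <= 1 -> i != j ->
  m i + d i * x <> m j + d j * y.
Hypothesis draws_s : draws s phi h m d K.
Hypothesis pic : picture s v cr.

(** Outside the blocks the curve avoids the image of the square, whereas a pass in a block takes
    place there. *)
Lemma drawing_partner p : flat_pair K p -> blocks (block m d) p.1 -> blocks (block m d) p.2.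
Proof.
case: p => a b [/= [a01 b01 ab e] _] [i [x x1 aE]].
have [sE sout _ _] := draws_s.
apply: contrapT => nb; apply: (sout b); first by split=> // /blocks_inside.
by exists (s i x); [exact: (picture_square pic) | rewrite -e aE sE].
Qed.

Lemma drawing_double i x j y : -1 <= x <= 1 -> -1 <= y <= 1 ->
  double (curve K) (m i + d i * x) (m j + d j * y) <-> s i x = s j y /\ (i, x) <> (j, y).
Proof.
move=> x1 y1; have [sE _ _ _] := draws_s; have [_ _ phi_inj _] := chart_phi.
split=> [[_ _ ne]|[e ne]].
  by rewrite !sE // => /phi_inj e; split=> // -[ij xy]; apply: ne; rewrite ij xy.
split; [| | |by rewrite !sE // e].
- by have /andP[/ltW -> /ltW ->] := strand_unit i x1.
- by have /andP[/ltW -> /ltW ->] := strand_unit j y1.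
move=> e'; have ij : i = j.
  apply: (block_disjoint strand_disjoint (u := m i + d i * x)); first by exists x.
  by rewrite e'; exists y.
by apply: ne; move: e'; rewrite ij => /(strand_inj d0) ->.
Qed.

Lemma drawing_flat i x j y : -1 <= x <= 1 -> -1 <= y <= 1 ->
  flat_pair K (m i + d i * x, m j + d j * y) <-> (x, (j, y)) \in cr i.
Proof.
move=> x1 y1; rewrite (picture_crossings pic) // -drawing_double //; split=> [[]//|dK]; split=> //=.
have [_ _ tag1 tag2] := draws_s.
have [e ne] := (drawing_double _ _ x1 y1).1 dK.
have [ij|ij] := eqVneq i j; last by rewrite (tag2 i j x y) //; case: ifP.
by rewrite ij in e ne *; apply: (tag1 _ x y) => // xy; apply: ne; rewrite xy.
Qed.

Lemma cr_closed i c : c \in cr i -> (-1 <= c.1 <= 1) && (-1 <= c.2.2 <= 1).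
Proof. by move=> /(picture_interior pic) [/andP[/ltW -> /ltW ->] /andP[/ltW -> /ltW ->]]. Qed.

(** Passage from sets of real parameters to explicit lists, on which sums can be evaluated. *)
Lemma flat_block i : flat_pair K `&` [set p | block m d i p.1] = [set` map (at_pair m d i) (cr i)].
Proof.
apply/seteqP; split=> [p [fp [x x1 pE]]|p /mapP[c cc ->]] /=.
  have [|j [y y1 qE]] := drawing_partner fp; first by exists i; exists x.
  move: fp; rewrite (surjective_pairing p) pE qE => /(drawing_flat _ _ x1 y1) cc.
  by apply/mapP; exists (x, (j, y)).
have /andP[x1 y1] := cr_closed cc.
by split; [apply/drawing_flat => //; case: c cc {x1 y1} => ? [] | exists c.1].
Qed.

Lemma map_at_pair_uniq i : uniq (map (at_pair m d i) (cr i)).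
Proof.
rewrite map_inj_in_uniq ?(picture_uniq pic) // => c c' /cr_closed cc /cr_closed cc'.
exact: (at_pair_inj d0 strand_disjoint).
Qed.

Lemma drawing_sum (V : nmodType) i (P : set (R * R)) (F : R * R -> V) :
  \sum_(p \in flat_pair K `&` [set p | block m d i p.1] `&` P) F p =
  \sum_(c <- cr i | `[< P (at_pair m d i c) >]) F (at_pair m d i c).
Proof. by rewrite (fsbig_list P F (map_at_pair_uniq i) (flat_block i)) big_map. Qed.

Lemma drawing_block_total i :
  block_total (block m d) K i = \sum_(c <- cr i) label_change K (at_pair m d i c).
Proof.
rewrite /block_total -[X in \sum_(p \in X) _]setIT drawing_sum.
by apply: eq_bigl => c; apply/asboolP.
Qed.

Lemma drawing_block_label i x :
  block_label (block m d) K i (m i + d i * x) =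
  \sum_(c <- cr i | d i * c.1 < d i * x) label_change K (at_pair m d i c).
Proof.
rewrite /block_label drawing_sum; apply: eq_bigl => c.
by rewrite asboolb /= ltrD2l.
Qed.

Lemma drawing_inner_sum (V : zmodType) (f : int -> int -> V) i :
  inner_sum (block m d) f K i =
  \sum_(c <- cr i | `[< tag K (m i + d i * c.1) = Over >])
    f (weight K (at_pair m d i c)) (sgn K (at_pair m d i c)).
Proof. by rewrite /inner_sum crossing_flatE setIAC drawing_sum. Qed.

(** The bounds are strict because the drawing determines the curve over [-1,1] only, and a
    derivative needs both sides. The factor undoes the speed [d i] of the parameter. *)
Lemma drawing_derive i x : -1 < x < 1 ->
  derive1 (curve K) (m i + d i * x) = (d i)^-1 *: 'd phi (s i x) (v i x).
Proof.
move=> x1; have [sE _ _ _] := draws_s; have [[dphi _] _ _ _] := chart_phi.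
have dr : is_derive x 1 (fun t => m i + d i * t) (d i).
  have dm := is_deriveD (is_derive_cst (m i) x 1) (is_deriveM (is_derive_cst (d i) x 1) (is_derive_id x 1)).
  by apply: is_derive_eq dm _; rewrite /GRing.scale /=; ring.
have h1 := is_derive_reparam dr (curve_is_derive K _).
have h2 := is_derive_diff_comp (picture_derive pic i x) (dphi _).
have <- := is_derive_near_unique _ h1 h2.
  by rewrite scalerA mulVf ?scale1r //; apply/eqP.
have /near_in_itvoo : x \in `]-1, 1[%R by rewrite in_itv.
by apply: filterS => t; rewrite in_itv /= => /andP[/ltW t0 /ltW t1]; rewrite sE // t0.
Qed.

(** The area is a product of the inverses of the two speeds, a planar determinant and the Jacobian
    area of the chart. All are nonzero, so multiplication of signs becomes equality of booleans. *)
Lemma drawing_left_incoming i c : c \in cr i ->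
  left_incoming K (at_pair m d i c) =
  (((0 < d i) == (0 < d c.2.1)) ==
   ((0 < det2 (v i c.1) (v c.2.1 c.2.2)) == (0 < jacobian_area (S := S) phi 0))).
Proof.
case: c => x [j y] cc; have [/= x1 y1] := picture_interior pic cc.
have /andP[/= x1' y1'] := cr_closed cc.
have [fd _] := (drawing_flat _ _ x1' y1').2 cc; have A0 := area_double_neq0 fd.
have [e _] := (drawing_double _ _ x1' y1').1 fd; have [sE _ _ _] := draws_s.
move: A0; rewrite /left_incoming /= !drawing_derive // sE // -e areaZ (chart_area (S := S)).
rewrite !mulf_eq0 !negb_or => /andP[/andP[di dj] /andP[D0 J0]].
rewrite !mulr_gt0_addb ?mulf_neq0 // !invr_gt0.
by rewrite (jacobian_area_same_sign chart_phi (s i x) 0).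
Qed.

Lemma drawing_tag i c : c \in cr i -> i != c.2.1 ->
  tag K (m i + d i * c.1) = if (h c.2.1 < h i)%N then Over else Under.
Proof.
case: c => x [j y] cc ij; have /andP[x1 y1] := cr_closed cc.
have [_ _ _ tag2] := draws_s; have [e _] := (picture_crossings pic _ _ x1 y1).1 cc.
exact: tag2 e.
Qed.

End Drawing.

(** * Two diagrams that draw different pictures in the same disk *)

Section Replace.
Context {R : realType} {S : surface} {n : nat}.
Variables (m d : 'I_n -> R) (phi : 'rV[R]_2 -> 'rV[R]_3) (h : 'I_n -> nat).
Variables (s v s' v' : 'I_n -> R -> 'rV[R]_2) (cr cr' : 'I_n -> seq (R * ('I_n * R))).
Variable K K' : diagram R S.
Hypothesis chart_phi : chart S phi.
Hypothesis d0 : forall i, d i <> 0.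
Hypothesis strand_unit : forall i x, -1 <= x <= 1 -> 0 < m i + d i * x < 1.
Hypothesis strand_disjoint : forall i j x y, -1 <= x <= 1 -> -1 <= y <= 1 -> i != j ->
  m i + d i * x <> m j + d j * y.
Hypotheses (draws_s : draws s phi h m d K) (draws_s' : draws s' phi h m d K').
Hypotheses (pic : picture s v cr) (pic' : picture s' v' cr').
Hypothesis curve_outside : forall u, outside m d u -> curve K' u = curve K u.
Hypothesis tag_outside : forall u v, outside m d u -> outside m d v ->
  double (curve K) u v -> tag K' u = tag K u.

Lemma blockE i u : block m d i u <-> m i - `|d i| <= u <= m i + `|d i|.
Proof.
have di : d i != 0 by apply/eqP.
have -> : (m i - `|d i| <= u <= m i + `|d i|) = (`|u - m i| <= `|d i|).
  by rewrite ler_norml lerBrDr [u - m i <= _]lerBlDr ![_ + m i]addrC.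
split=> [[x x1 ->]|le].
  by rewrite addrC addKr normrM ler_piMr // ler_norml.
exists ((u - m i) / d i); last by field.
by rewrite -ler_norml normrM normfV ler_pdivrMr ?normr_gt0 // mul1r.
Qed.

(** The blocks are finitely many closed intervals. Agreement of the curves outside them therefore
    gives agreement of derivatives. *)
Lemma near_not_blocks (u : R) : ~ blocks (block m d) u -> \near u, ~ blocks (block m d) u.
Proof.
move=> nu.
have : \forall t \near u, forall i, ~ block m d i t.
  apply: (@filter_forall _ _ _ (nbhs u)) => i.
  have /near_outside : ~ m i - `|d i| <= u <= m i + `|d i|.
    by move=> /blockE bu; apply: nu; exists i.
  by apply: filterS => t nt /blockE.
by apply: filterS => t nt [i]; exact: nt.
Qed.

Lemma outside_blocks u : 0 <= u <= 1 -> ~ blocks (block m d) u -> outside m d u.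
Proof. by move=> u01 nu; split=> // /blocks_inside. Qed.

Lemma derive_outside (u : R) : 0 < u < 1 -> ~ blocks (block m d) u ->
  derive1 (curve K') u = derive1 (curve K) u.
Proof.
move=> u01 nu; apply: derive1_val; apply: near_eq_is_derive (curve_is_derive K u).
apply: filterS2 (near_unit u01) (near_not_blocks nu) => x x01 nx.
by rewrite curve_outside //; exact: outside_blocks.
Qed.

Lemma outside_partner (L : diagram R S) p :
  (forall p, flat_pair L p -> blocks (block m d) p.1 -> blocks (block m d) p.2) ->
  flat_pair L p -> ~ blocks (block m d) p.1 -> ~ blocks (block m d) p.2.
Proof. by move=> H; case: p => a b /flat_pair_sym fp na nb; apply: na; exact: H fp nb. Qed.

Let partner := drawing_partner draws_s pic.
Let partner' := drawing_partner draws_s' pic'.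

Lemma flat_outside p : ~ blocks (block m d) p.1 -> flat_pair K p <-> flat_pair K' p.
Proof.
move=> na; split=> fp.
  have nb := outside_partner partner fp na.
  case: p na nb fp => a b /= na nb [/= dK t].
  have [a01 b01 ab e] := dK.
  have oa := outside_blocks a01 na; have ob := outside_blocks b01 nb.
  by split=> /=; [split=> //; rewrite !curve_outside | rewrite (tag_outside oa ob dK)].
have nb := outside_partner partner' fp na.
case: p na nb fp => a b /= na nb [/= [a01 b01 ab e] t].
have oa := outside_blocks a01 na; have ob := outside_blocks b01 nb.
have dK : double (curve K) a b by split=> //; rewrite -!curve_outside.
by split=> //=; rewrite -(tag_outside oa ob dK).
Qed.

Lemma left_outside p : ~ blocks (block m d) p.1 -> flat_pair K p ->
  left_incoming K' p = left_incoming K p.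
Proof.
move=> na fp; have nb := outside_partner partner fp na.
case: p na nb fp => a b /= na nb [/= dK t].
have ia := double_not_end dK; have ib := double_not_end (double_sym dK).
have [a01 b01 _ _] := dK.
apply: (@left_incoming_scale _ _ _ _ _ _ 1 1) => //=; rewrite ?scale1r.
- by apply: curve_outside; exact: outside_blocks.
- exact: derive_outside.
- exact: derive_outside.
Qed.

Lemma tag_outside_pair p : ~ blocks (block m d) p.1 -> flat_pair K p -> tag K' p.1 = tag K p.1.
Proof.
move=> na fp; have nb := outside_partner partner fp na.
case: p na nb fp => a b /= na nb [/= dK t].
have [a01 b01 _ _] := dK.
exact: tag_outside (outside_blocks a01 na) (outside_blocks b01 nb) dK.
Qed.

Hypothesis same_total : forall i,
  \sum_(c <- cr i) label_change K (at_pair m d i c) =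
  \sum_(c <- cr' i) label_change K' (at_pair m d i c).

Let same_block_total i : block_total (block m d) K i = block_total (block m d) K' i.
Proof.
rewrite (drawing_block_total chart_phi d0 strand_unit strand_disjoint draws_s pic).
by rewrite (drawing_block_total chart_phi d0 strand_unit strand_disjoint draws_s' pic').
Qed.

(** The times [x] and [y] are independent, since corresponding crossings may be passed at different
    times in the two pictures. *)
Lemma drawing_label i x y : -1 <= x <= 1 -> -1 <= y <= 1 ->
  label K (m i + d i * x) - \sum_(c <- cr i | d i * c.1 < d i * x) label_change K (at_pair m d i c) =
  label K' (m i + d i * y) - \sum_(c <- cr' i | d i * c.1 < d i * y) label_change K' (at_pair m d i c).
Proof.
move=> x1 y1.
have := label_inside (block_convex d0) (block_disjoint strand_disjoint)
  flat_outside left_outside same_block_total (block_strand m d i x1) (block_strand m d i y1).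
rewrite (drawing_block_label chart_phi d0 strand_unit strand_disjoint draws_s pic).
by rewrite (drawing_block_label chart_phi d0 strand_unit strand_disjoint draws_s' pic').
Qed.

Lemma drawing_crossing_sum (V : zmodType) (f : int -> int -> V) :
  \sum_i \sum_(c <- cr i | `[< tag K (m i + d i * c.1) = Over >])
    f (weight K (at_pair m d i c)) (sgn K (at_pair m d i c)) =
  \sum_i \sum_(c <- cr' i | `[< tag K' (m i + d i * c.1) = Over >])
    f (weight K' (at_pair m d i c)) (sgn K' (at_pair m d i c)) ->
  crossing_sum K f = crossing_sum K' f.
Proof.
move=> E; apply: (replacement_crossing_sum (block_convex d0) (block_disjoint strand_disjoint)
  partner flat_outside left_outside tag_outside_pair same_block_total).
rewrite (eq_bigr _ (fun i _ => drawing_inner_sum chart_phi d0 strand_unit strand_disjoint draws_s pic f i)).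
rewrite (eq_bigr _ (fun i _ => drawing_inner_sum chart_phi d0 strand_unit strand_disjoint draws_s' pic' f i)).
exact: E.
Qed.

End Replace.

(** * The Reidemeister moves *)

Section Pictures.
Context {R : realType}.

Lemma pt_inj (a b c d : R) : pt a b = pt c d <-> a = c /\ b = d.
Proof.
split=> [e|[-> ->]] //; move/rowP: e => e.
by move: (e ord0) (e ord_max); rewrite !mxE.
Qed.

Lemma in_square_pt (a b : R) : -1 <= a <= 1 -> -1 <= b <= 1 -> in_square (pt a b).
Proof. by move=> ha hb [[|[|//]] k]; rewrite mxE. Qed.

Lemma is_derive_pt (a b : R -> R) (x a' b' : R) :
  is_derive x 1 a a' -> is_derive x 1 b b' ->
  is_derive x 1 (fun t => pt (a t) (b t)) (pt a' b').
Proof.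
move=> [da <-] [db <-].
have E (i : 'I_1) (j : 'I_2) : (fun t => pt (a t) (b t) i j) = if j == ord0 then a else b.
  by apply/funext => t; rewrite mxE; case: j => -[|[|//]] k.
have dpt : derivable (fun t => pt (a t) (b t)) x 1.
  apply: (proj2 (derivable_mxP (fun t => pt (a t) (b t)) x 1)) => i j.
  have H (p : bool) : derivable (if p then a else b) x 1.
    by case: p; [exact: da | exact: db].
  rewrite (E i j); exact: H.
apply: (DeriveDef dpt); rewrite derive_mx //.
by apply/rowP => j; rewrite !mxE E; case: j => -[|[|//]] k.
Qed.

Lemma is_derive_bump (x : R) : is_derive x 1 (@bump R) (- 4 * x * (1 - x ^+ 2)).
Proof.
have -> : @bump R = (cst 1 - id ^+ 2) ^+ 2 by apply/funext.
have h := is_deriveX 2 (is_deriveB (is_derive_cst (1 : R) x 1) (is_deriveX 2 (is_derive_id x 1))).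
by apply: is_derive_eq h _; rewrite /GRing.scale /= ?fctE /=; ring.
Qed.

Lemma bump_itv (x : R) : -1 <= x <= 1 -> 0 <= bump x <= 1.
Proof. move=> /andP[x0 x1]; rewrite /bump.
have /andP[y0 y1] : 0 <= 1 - x ^+ 2 <= 1.
  by rewrite lerBlDr lerDl sqr_ge0 andbT; nra.
by rewrite exprn_ge0 // exprn_ile1.
Qed.

Lemma bump_eq (x : R) : -1 <= x <= 1 -> bump x = 9 / 16 -> x = 1 / 2 \/ x = - (1 / 2).
Proof.
move=> x1 e; have : (x - 1 / 2) * (x + 1 / 2) = 0.
  (* Difference of squares: 9/16 is the square of 3/4, and the factor 7/4 - x^2 is positive on
     [-1,1]. *)
  have h : ((x - 1 / 2) * (x + 1 / 2)) * (7 / 4 - x ^+ 2) = 0.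
    by transitivity (9 / 16 - bump x); [rewrite /bump; field | rewrite e subrr].
  move/eqP: h; rewrite mulf_eq0 => /orP[/eqP //|/eqP h].
  by move: x1 => /andP[x0 x1]; exfalso; nra.
move=> /eqP; rewrite mulf_eq0 => /orP[] /eqP h; [left | right]; lra.
Qed.

Lemma bump_half : bump (1 / 2 : R) = 9 / 16 /\ bump (- (1 / 2) : R) = 9 / 16.
Proof. by rewrite /bump; split; field. Qed.

Lemma line_picture : picture (fun _ : 'I_1 => @line R) (fun _ _ => pt 1 0) (fun=> [::]).
Proof.
split=> //.
- by move=> i x x1; apply: in_square_pt => //; apply/andP; split; lra.
- by move=> i x; exact: is_derive_pt.
- by move=> i x j y _ _; rewrite !ord1; split=> // -[/pt_inj[-> _]].
Qed.

Definition curl_crossings (_ : 'I_1) : seq (R * ('I_1 * R)) :=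
  [:: (1 / 2, (ord0, - (1 / 2))); (- (1 / 2), (ord0, 1 / 2))].

Lemma curl_picture : exists v, picture (fun _ : 'I_1 => @curl R) v curl_crossings.
Proof.
have dc (x : R) : is_derive x 1 (fun x : R => x * (1 - 16 / 9 * bump x))
    ((1 - 16 / 9 * bump x) + x * (- (16 / 9) * (- 4 * x * (1 - x ^+ 2)))).
  have h := is_deriveM (is_derive_id x 1) (is_deriveB (is_derive_cst (1 : R) x 1)
    (is_deriveM (is_derive_cst (16 / 9 : R) x 1) (is_derive_bump x))).
  by apply: is_derive_eq h _; rewrite /GRing.scale /= ?fctE /=; ring.
have db (x : R) : is_derive x 1 (fun x : R => 1 / 2 * bump x) (1 / 2 * (- 4 * x * (1 - x ^+ 2))).
  have h := is_deriveM (is_derive_cst (1 / 2 : R) x 1) (is_derive_bump x).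
  by apply: is_derive_eq h _; rewrite /GRing.scale /= ?fctE /=; ring.
exists (fun _ x => pt (1 - 16 / 9 * bump x + x * (- (16 / 9) * (- 4 * x * (1 - x ^+ 2))))
                  (1 / 2 * (- 4 * x * (1 - x ^+ 2)))).
have [bh bnh] := bump_half.
split.
- move=> i x x1; have /andP[b0 b1] := bump_itv x1; move/andP: x1 => [x0 x1].
  by apply: in_square_pt; apply/andP; split; nra.
- by move=> i x; exact: is_derive_pt.
- move=> i; rewrite /= inE andbT; apply/eqP => /(f_equal fst) /=; lra.
- by move=> i c; rewrite !inE => /orP[] /eqP -> /=; split; apply/andP; split; lra.
move=> i x j y x1 y1; rewrite !ord1 !inE; split.
  case/orP => /eqP[-> ->]; (split; [apply/pt_inj; rewrite bh bnh; split; lra | case; lra]).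
move=> [/pt_inj[e1 e2] ne].
have be : bump x = bump y by lra.
have xy : x <> y by move=> xy; apply: ne; rewrite xy.
have b : bump x = 9 / 16.
  (* Equal heights give equal bumps, so the first coordinates differ by this product. The constant
     16/9 is the inverse of the bump at 1/2, which places the crossing at the times 1/2 and -1/2. *)
  have : (x - y) * (1 - 16 / 9 * bump x) = 0 by rewrite mulrBl e1 be subrr.
  by move=> /eqP; rewrite mulf_eq0 => /orP[] /eqP h; [exfalso; apply: xy | ]; lra.
have [ex|ex] := bump_eq x1 b; have [ey|ey] := bump_eq y1 (etrans (esym be) b);
  rewrite ex ey ?eqxx ?orbT //; exfalso; apply: xy; rewrite ex ey //.
Qed.

End Pictures.

Lemma ltr_mull (R : realDomainType) (a x y : R) : a != 0 ->
  (a * x < a * y) = if 0 < a then x < y else y < x.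
Proof.
move=> a0; have [an|ap|e] := ltgtP a 0; last by rewrite e eqxx in a0.
  by rewrite ltr_nM2l.
by rewrite ltr_pM2l.
Qed.

(** The labels at the two passes of the curl differ by the change at the pass met first. As the two
    changes are opposite, this difference cancels the last term of [weightE], whichever pass comes
    first. *)
Lemma Omega1_crossing_sum (R : realType) (S : surface) (V : zmodType) (f : int -> int -> V)
  (K K' : diagram R S) : (forall e, f 0 e = 0) -> Omega1 K K' ->
  crossing_sum K f = crossing_sum K' f.
Proof.
move=> f0 [phi [h [m [d [[cphi _] [d0 unit] disj [dK dK'] [out tout]]]]]].
have [v' pic'] := @curl_picture R.
have half1 : -1 <= (1 / 2 : R) <= 1 by apply/andP; split; lra.
have nhalf1 : -1 <= (- (1 / 2) : R) <= 1 by apply/andP; split; lra.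
have zero1 : -1 <= (0 : R) <= 1 by apply/andP; split; lra.
have [duw _] : flat_pair K' (m ord0 + d ord0 * (1 / 2), m ord0 + d ord0 * - (1 / 2)).
  by apply/(drawing_flat cphi d0 unit disj dK' pic' _ _ half1 nhalf1); rewrite !inE eqxx.
have eC := label_changeC duw.
have tot (i : 'I_1) : \sum_(c <- [::]) label_change K (at_pair m d i c) =
    \sum_(c <- curl_crossings i) label_change K' (at_pair m d i c).
  by rewrite big_nil !big_cons big_nil addr0 /at_pair /= (ord1 i : i = ord0) eC subrr.
(* The straight strand has no crossing, so its label is constant; time 0 serves as reference. *)
have lab := drawing_label cphi d0 unit disj dK dK' (line_picture (R := R)) pic' out tout tot ord0 zero1.
have := lab _ half1; have := lab _ nhalf1; have d00 : d ord0 != 0 by apply/eqP.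
rewrite !big_cons !big_nil /at_pair /= eC !(ltr_mull _ _ d00) !ltxx.
have -> : (1 / 2 < - (1 / 2) :> R) = false by apply/negbTE; rewrite -leNgt; lra.
have -> : (- (1 / 2) < 1 / 2 :> R) = true by lra.
move=> l1 l2.
apply: (drawing_crossing_sum cphi d0 unit disj dK dK' line_picture pic' out tout tot).
rewrite [LHS]big1 => [|i _]; last by rewrite big_nil.
rewrite big1 // => i _; rewrite (ord1 i : i = ord0) big_seq_cond big1 // => c.
(* Which pass is the upper one is left open: both list entries get weight 0. *)
rewrite !inE => /andP[/orP[] /eqP -> _]; rewrite weightE /at_pair /= ?eC.
  rewrite (_ : _ + _ = 0) ?f0 //.
  by move: l1 l2; case: (0 < d ord0) => /=; lia.
rewrite (_ : _ + _ = 0) ?f0 //.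
by move: l1 l2; case: (0 < d ord0) => /=; lia.
Qed.

(** * Pictures whose strands are graphs of functions *)

Section Graphs.
Context {R : realType} {n : nat}.
Variables (s : 'I_n -> R -> 'rV[R]_2) (g g' : 'I_n -> R -> R) (r : 'I_n -> seq (R * 'I_n)).

Definition graph_velocity (i : 'I_n) (x : R) : 'rV[R]_2 := pt 1 (g' i x).

Definition graph_crossings (i : 'I_n) := [seq (c.1, (c.2, c.1)) | c <- r i].

(** The abscissa of a point is its time. Hence a strand never crosses itself, two strands cross at a
    common time, and crossings are solutions of an equation between heights. *)
Lemma graph_picture :
  (forall i x, s i x = pt x (g i x)) ->
  (forall i x, -1 <= x <= 1 -> -1 <= g i x <= 1) ->
  (forall i (x : R), is_derive x 1 (g i) (g' i x)) ->
  (forall i, uniq (r i)) ->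
  (forall i c, c \in r i -> -1 < c.1 < 1) ->
  (forall i j x, -1 <= x <= 1 -> (x, j) \in r i <-> i != j /\ g i x = g j x) ->
  picture s graph_velocity graph_crossings.
Proof.
move=> sE g1 dg r_uniq r_int rP.
split.
- by move=> i x x1; rewrite sE; apply: in_square_pt => //; exact: g1.
- move=> i x; rewrite (_ : s i = fun t => pt t (g i t)); last exact/funext.
  exact: is_derive_pt.
- by move=> i; rewrite map_inj_uniq // => -[x j] [y k] [-> ->].
- by move=> i c /mapP[b /r_int b1 ->].
move=> i x j y x1 y1; rewrite !sE; split.
  move=> /mapP[[z k] /= + [-> -> ->]] => /[dup] /r_int /andP[/ltW z0 /ltW z1].
  move=> /rP[|ij e]; first by rewrite z0.
  by split; [rewrite e | case=> ik; rewrite ik eqxx in ij].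
move=> [/pt_inj[xy e] ne]; rewrite -xy in e ne *.
apply/mapP; exists (x, j) => //; apply/rP => //; split=> //.
by apply/eqP => ij; apply: ne; rewrite ij.
Qed.

Lemma graph_det2 i j x :
  det2 (graph_velocity i x) (graph_velocity j x) = g' j x - g' i x.
Proof. by rewrite /det2 !mxE /=; ring. Qed.

End Graphs.

Section Omega2.
Context {R : realType}.

Definition line_high_height (i : 'I_2) : R -> R := nth (fun=> 0) [:: (fun=> 0); (fun=> 9 / 16)] i.

Lemma ord2P (P : 'I_2 -> Prop) : P ord0 -> P ord_max -> forall i, P i.
Proof.
move=> P0 P1 [[|[|//]] k]; first by rewrite (_ : Ordinal k = ord0) //; exact: val_inj.
by rewrite (_ : Ordinal k = ord_max) //; exact: val_inj.
Qed.

Lemma line_high_picture :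
  picture (fun i : 'I_2 => nth (@line R) [:: @line R; @high R] i)
    (graph_velocity (fun _ _ => 0)) (graph_crossings (fun=> [::])).
Proof.
apply: (@graph_picture _ _ _ line_high_height) => //.
- by elim/ord2P.
- by elim/ord2P => x x1; rewrite /line_high_height /=; apply/andP; split; lra.
- by elim/ord2P => x; exact: is_derive_cst.
- elim/ord2P; elim/ord2P => x x1; split=> // -[//]; rewrite /line_high_height /=; lra.
Qed.

Definition line_dip_height (i : 'I_2) : R -> R :=
  nth (fun=> 0) [:: (fun=> 0); (fun x => 9 / 16 - bump x)] i.

Definition line_dip_slope (i : 'I_2) : R -> R :=
  nth (fun=> 0) [:: (fun=> 0); (fun x => 4 * x * (1 - x ^+ 2))] i.

(** [rev_ord] exchanges the two strands. *)
Definition line_dip_crossings (i : 'I_2) : seq (R * 'I_2) :=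
  [:: (1 / 2, rev_ord i); (- (1 / 2), rev_ord i)].

Lemma line_dip_picture :
  picture (fun i : 'I_2 => nth (@line R) [:: @line R; @dip R] i)
    (graph_velocity line_dip_slope) (graph_crossings line_dip_crossings).
Proof.
have [bh bnh] := @bump_half R.
apply: (@graph_picture _ _ _ line_dip_height).
- by elim/ord2P.
- elim/ord2P => x x1; rewrite /line_dip_height /=; first by apply/andP; split; lra.
  by have /andP[b0 b1] := bump_itv x1; apply/andP; split; lra.
- elim/ord2P => x; first exact: is_derive_cst.
  have h := is_deriveB (is_derive_cst (9 / 16 : R) x 1) (is_derive_bump x).
  by apply: is_derive_eq h _; rewrite /line_dip_slope /=; ring.
- move=> i; rewrite /= inE andbT; apply/eqP => /(f_equal fst) /=; lra.
- by move=> i c; rewrite !inE => /orP[] /eqP -> /=; apply/andP; split; lra.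
have crossE (i j : 'I_2) (x : R) :
    (x, j) \in line_dip_crossings i <-> j = rev_ord i /\ (x = 1 / 2 \/ x = - (1 / 2)).
  rewrite !inE; split; first by case/orP => /eqP[-> ->]; split=> //; [left | right].
  by case=> -> [->|->]; rewrite eqxx ?orbT.
have rev01 : rev_ord ord0 = ord_max :> 'I_2 by exact: val_inj.
have rev10 : rev_ord ord_max = ord0 :> 'I_2 by exact: val_inj.
have dipE (x : R) : -1 <= x <= 1 -> 9 / 16 - bump x = 0 <-> (x = 1 / 2 \/ x = - (1 / 2)).
  by move=> x1; split=> [e|[->|->]]; [apply: bump_eq => // | | ]; lra.
elim/ord2P; elim/ord2P => x x1; rewrite crossE ?rev01 ?rev10 /line_dip_height /=.
- by split=> -[].
- split=> [[_ /(dipE x x1) e]|[_ e]]; split=> //.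
  by apply/(dipE x x1).
- split=> [[_ /(dipE x x1) e]|[_ e]]; split=> //.
  by apply/(dipE x x1).
- by split=> -[].
Qed.

(** The slope of the dip is an odd function of time, and the line has slope 0. *)
Lemma line_dip_sign (i : 'I_2) :
  (0 < det2 (graph_velocity line_dip_slope i (- (1 / 2)))
            (graph_velocity line_dip_slope (rev_ord i) (- (1 / 2)))) =
  ~~ (0 < det2 (graph_velocity line_dip_slope i (1 / 2))
               (graph_velocity line_dip_slope (rev_ord i) (1 / 2))).
Proof.
rewrite !graph_det2 -leNgt; elim/ord2P: i.
  rewrite (_ : rev_ord ord0 = ord_max); last exact: val_inj.
  by rewrite /line_dip_slope /=; apply/idP/idP => h; exfalso; lra.
rewrite (_ : rev_ord ord_max = ord0); last exact: val_inj.
by rewrite /line_dip_slope /=; apply/idP/idP => _; lra.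
Qed.

End Omega2.

Section SumRules.
Context {R : realType} {S : surface} {V : zmodType} (f : int -> int -> V).
Implicit Types K : diagram R S.

Lemma Omega2_crossing_sum K K' : (forall w e, f w (- e) = - f w e) -> Omega2 K K' ->
  crossing_sum K f = crossing_sum K' f.
Proof.
move=> fN [phi [h [m [d [[cphi _] [d0 unit] disj [dK dK'] [out tout]]]]]].
have pic := @line_high_picture R; have pic' := @line_dip_picture R.
have d0' i : d i != 0 by apply/eqP.
have half1 : -1 <= (1 / 2 : R) <= 1 by apply/andP; split; lra.
have nhalf1 : -1 <= (- (1 / 2) : R) <= 1 by apply/andP; split; lra.
have zero1 : -1 <= (0 : R) <= 1 by apply/andP; split; lra.
pose P i (x : R) := (m i + d i * x, m (rev_ord i) + d (rev_ord i) * x).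
pose e i x := label_change K' (P i x).
have mem i x : x = 1 / 2 \/ x = - (1 / 2) ->
    (x, (rev_ord i, x)) \in graph_crossings (@line_dip_crossings R) i.
  by case=> ->; rewrite !inE eqxx ?orbT.
have flatP i x : x = 1 / 2 \/ x = - (1 / 2) -> flat_pair K' (P i x).
  move=> xE; have x1 : -1 <= x <= 1 by case: xE => ->.
  by apply/(drawing_flat cphi d0 unit disj dK' pic' _ _ x1 x1); exact: mem.
have eC i x : x = 1 / 2 \/ x = - (1 / 2) -> e (rev_ord i) x = - e i x.
  by move=> xE; have [dP _] := flatP i _ xE; rewrite /e /P rev_ordK (label_changeC dP).
have eN i : e i (- (1 / 2)) = - e i (1 / 2).
  have lE x : x = 1 / 2 \/ x = - (1 / 2) -> left_incoming K' (P i x) = _ :=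
    fun xE => drawing_left_incoming cphi d0 unit disj dK' pic' (mem i x xE).
  rewrite /e /label_change (lE (1 / 2)); last by left.
  rewrite (lE (- (1 / 2))); last by right.
  by rewrite line_dip_sign; do 4!case: (0 < _); rewrite ?opprK.
have tot i : \sum_(c <- graph_crossings (fun=> [::]) i) label_change K (at_pair m d i c) =
    \sum_(c <- graph_crossings (@line_dip_crossings R) i) label_change K' (at_pair m d i c).
  rewrite big_nil !big_cons big_nil addr0 /at_pair /=.
  by rewrite -/(P i (1 / 2)) -/(P i (- (1 / 2))) -/(e i _) -/(e i _) eN subrr.
apply: (drawing_crossing_sum cphi d0 unit disj dK dK' pic pic' out tout tot).
rewrite [LHS]big1 => [|i _]; last by rewrite big_nil.
rewrite big1 // => i _.
have ni : i != rev_ord i by elim/ord2P: i.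
rewrite !big_cons big_nil /=.
rewrite (drawing_tag dK' pic' (mem i _ (or_introl erefl)) ni).
rewrite (drawing_tag dK' pic' (mem i _ (or_intror erefl)) ni).
(* One strand is above the other at both crossings, so its list contributes both terms and the other
   list none. *)
case: (h _ < h i)%N; last by rewrite asboolF.
rewrite asboolT // addr0.
have ltnn : (1 / 2 < - (1 / 2) :> R) = false by apply/negbTE; rewrite -leNgt; lra.
have ltnp : (- (1 / 2) < 1 / 2 :> R) = true by lra.
(* All labels are expressed through the constant label of the strand in [K], read at time 0, so that
   the weights can be compared by boolean cases and linear arithmetic. *)
have lab k x : -1 <= x <= 1 -> label K' (m k + d k * x) = label K (m k + d k * 0) +
    ((if d k * (1 / 2) < d k * x then e k (1 / 2) else 0) +
     (if d k * - (1 / 2) < d k * x then e k (- (1 / 2)) else 0)).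
  move=> x1; have := drawing_label cphi d0 unit disj dK dK' pic pic' out tout tot k zero1 x1.
  rewrite big_nil subr0 => ->.
  have -> : \sum_(c <- graph_crossings (@line_dip_crossings R) k | d k * c.1 < d k * x)
      label_change K' (at_pair m d k c) = 
    ((if d k * (1 / 2) < d k * x then e k (1 / 2) else 0) +
     (if d k * - (1 / 2) < d k * x then e k (- (1 / 2)) else 0)).
    by rewrite !big_cons big_nil; do 2!case: (_ < _); rewrite ?addr0 ?add0r.
  by rewrite subrK.
have eCp := eC i _ (or_introl erefl).
have lp := lab i _ half1; have ln := lab i _ nhalf1.
have lrp := lab (rev_ord i) _ half1; have lrn := lab (rev_ord i) _ nhalf1.
rewrite !(eN, eCp, ltr_mull _ _ (d0' _), ltxx, ltnn, ltnp) in lp ln lrp lrn.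
rewrite !weightE !sgnE -/(e i _) -/(e i _) eN (fN _ (- e i _)).
rewrite lp ln lrp lrn.
apply/eqP; rewrite subr_eq0; apply/eqP; congr f.
move: (0 < d i) (0 < d (rev_ord i)) (label K _) (label K _) (e i _); clear.
by case=> -[]; lia.
Qed.

End SumRules.

(** * The third Reidemeister move *)

Section Omega3.
Context {R : realType}.

Lemma ord3P (P : 'I_3 -> Prop) : P i0 -> P i1 -> P i2 -> forall i, P i.
Proof.
move=> P0 P1 P2 [[|[|[|//]]] k].
- by rewrite (_ : Ordinal k = i0) //; exact: val_inj.
- by rewrite (_ : Ordinal k = i1) //; exact: val_inj.
- by rewrite (_ : Ordinal k = i2) //; exact: val_inj.
Qed.

Definition others (i : 'I_3) : seq 'I_3 := [seq j <- [:: i0; i1; i2] | j != i].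

(* The parameter at which strand [i] meets strand [j]: [a] is 1/2 when the third
   strand passes below, and -1/2 when it passes above. *)
Definition cross_at (a : R) (i j : 'I_3) : R :=
  nth 0 (nth [::] [:: [:: 0; 0; - a]; [:: 0; 0; a]; [:: - a; a; 0]] i) j.

Definition triangle_crossings (a : R) (i : 'I_3) : seq (R * 'I_3) :=
  [seq (cross_at a i j, j) | j <- others i].

Definition below_height (i : 'I_3) : R -> R :=
  nth (fun=> 0) [:: (fun x => x / 2); (fun x => - x / 2); (fun=> - 1 / 4)] i.

Definition below_slope (i : 'I_3) : R -> R :=
  nth (fun=> 0) [:: (fun=> 1 / 2); (fun=> - (1 / 2)); (fun=> 0)] i.

Definition above_height (i : 'I_3) : R -> R :=
  nth (fun=> 0) [:: (fun x => x / 2); (fun x => - x / 2);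
                    (fun x => - 1 / 4 + 8 / 9 * bump x)] i.

Definition above_slope (i : 'I_3) : R -> R :=
  nth (fun=> 0) [:: (fun=> 1 / 2); (fun=> - (1 / 2));
                    (fun x => - (32 / 9) * x * (1 - x ^+ 2))] i.

Lemma mem_others i j : (j \in others i) = (i != j).
Proof. by rewrite mem_filter eq_sym; elim/ord3P: j; rewrite !inE eqxx ?orbT andbT. Qed.

Lemma triangle_uniq a i : uniq (triangle_crossings a i).
Proof.
rewrite map_inj_uniq; last by move=> j k [].
by rewrite filter_uniq.
Qed.

Lemma triangle_mem a i j x :
  (x, j) \in triangle_crossings a i <-> i != j /\ x = cross_at a i j.
Proof.
split=> [/mapP[k + [-> ->]]|[ij ->]]; first by rewrite mem_others.
by apply/mapP; exists j; rewrite ?mem_others.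
Qed.

Lemma triangle_interior a i c : -1 < a < 1 -> c \in triangle_crossings a i -> -1 < c.1 < 1.
Proof.
case: c => x j a1 /triangle_mem[_ ->] /=.
by elim/ord3P: i; elim/ord3P: j; rewrite /cross_at /=; move/andP: a1 => [? ?];
  apply/andP; split; lra.
Qed.

Lemma is_derive_mulr_const (a x : R) : is_derive x 1 (fun t => t * a) a.
Proof.
have h := is_deriveM (is_derive_id x 1) (is_derive_cst a x 1).
by apply: is_derive_eq h _; rewrite /GRing.scale /=; ring.
Qed.

Lemma is_derive_rising (x : R) : is_derive x 1 (fun t => t / 2) (1 / 2).
Proof. by rewrite div1r; exact: is_derive_mulr_const. Qed.

Lemma is_derive_falling (x : R) : is_derive x 1 (fun t => - t / 2) (- (1 / 2)).
Proof.
rewrite (_ : (fun t => - t / 2) = fun t => t * - (1 / 2)); first exact: is_derive_mulr_const.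
by apply/funext => t; lra.
Qed.

Lemma below_picture :
  picture (fun i : 'I_3 => nth (@line R) [:: @rising R; @falling R; @below R] i)
    (graph_velocity below_slope) (graph_crossings (triangle_crossings (1 / 2))).
Proof.
apply: (@graph_picture _ _ _ below_height).
- by elim/ord3P.
- by elim/ord3P => x /andP[x0 x1]; rewrite /below_height /=; apply/andP; split; lra.
- elim/ord3P => x; [exact: is_derive_rising | exact: is_derive_falling | exact: is_derive_cst].
- exact: triangle_uniq.
- by move=> i c; apply: triangle_interior; apply/andP; split; lra.
move=> i j x _; rewrite triangle_mem.
by elim/ord3P: i; elim/ord3P: j; rewrite /cross_at /below_height /=;
  split=> -[// _ e]; split=> //; lra.
Qed.

Lemma above_rising (x : R) : -1 <= x <= 1 -> - 1 / 4 + 8 / 9 * bump x = x / 2 -> x = 1 / 2.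
Proof.
move=> /andP[x0 x1]; rewrite /bump => e.
(* The cubic factor is negative on [-1,1]. *)
have h : (2 * x - 1) * (16 * x ^+ 3 + 8 * x ^+ 2 - 28 * x - 23) = 0 by lra.
move/eqP: h; rewrite mulf_eq0 => /orP[/eqP ?|/eqP c]; first by lra.
(* The cubic equals -16 (1+x)^2 (1-x) - 8 (x+3/4)^2 - 5/2. *)
have h1 : 0 <= (1 + x) ^+ 2 * (1 - x) by rewrite mulr_ge0 ?sqr_ge0 // subr_ge0.
have h2 := sqr_ge0 (x + 3 / 4).
by exfalso; lra.
Qed.

Lemma above_picture :
  picture (fun i : 'I_3 => nth (@line R) [:: @rising R; @falling R; @above R] i)
    (graph_velocity above_slope) (graph_crossings (triangle_crossings (- (1 / 2)))).
Proof.
have [bh bnh] := @bump_half R.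
have bumpN (x : R) : bump (- x) = bump x by rewrite /bump sqrrN.
(* [above] is even in x and [falling] is the mirror image of [rising], so this intersection follows
   by x -> -x. *)
have falls (x : R) : -1 <= x <= 1 -> - 1 / 4 + 8 / 9 * bump x = - x / 2 -> x = - (1 / 2).
  move=> /andP[x0 x1] e; have : - x = 1 / 2; last by lra.
  by apply: above_rising; [apply/andP; split; lra | rewrite bumpN].
apply: (@graph_picture _ _ _ above_height).
- by elim/ord3P.
- elim/ord3P => x x1; have /andP[b0 b1] := bump_itv x1; move/andP: x1 => [x0 x1];
  by rewrite /above_height /=; apply/andP; split; lra.
- elim/ord3P => x; [exact: is_derive_rising | exact: is_derive_falling |].
  have h := is_deriveD (is_derive_cst (- 1 / 4 : R) x 1)
    (is_deriveM (is_derive_cst (8 / 9 : R) x 1) (is_derive_bump x)).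
  by apply: is_derive_eq h _; rewrite /above_slope /GRing.scale /=; field.
- exact: triangle_uniq.
- by move=> i c; apply: triangle_interior; apply/andP; split; lra.
move=> i j x x1; rewrite triangle_mem.
elim/ord3P: i; elim/ord3P: j; rewrite /cross_at /above_height /=;
  split=> -[// _ e]; split=> //; rewrite ?e ?opprK ?bh ?bnh; try lra.
- exact: above_rising.
- exact: falls.
- exact: above_rising.
- exact: falls.
Qed.

(* Whether strand [j] crosses strand [i] upwards; the same in both pictures. *)
Definition upper (i j : 'I_3) : bool :=
  nth false (nth [::] [:: [:: false; false; false]; [:: true; false; true];
                          [:: true; false; false]] i) j.

Lemma below_sign i j : i != j ->
  (0 < det2 (graph_velocity below_slope i (cross_at (1 / 2) i j))
            (graph_velocity below_slope j (cross_at (1 / 2) i j))) = upper i j.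
Proof.
rewrite graph_det2; elim/ord3P: i; elim/ord3P: j => // _;
  rewrite /below_slope /cross_at /upper /=; apply/idP/idP => //; lra.
Qed.

(** At its crossings with [rising] and [falling] the curved strand has slopes -4/3 and 4/3. They
    compare with 1/2 and -1/2 in the same way as the slope 0 of [below]. *)
Lemma above_sign i j : i != j ->
  (0 < det2 (graph_velocity above_slope i (cross_at (- (1 / 2)) i j))
            (graph_velocity above_slope j (cross_at (- (1 / 2)) i j))) = upper i j.
Proof.
rewrite graph_det2; elim/ord3P: i; elim/ord3P: j => // _;
  rewrite /above_slope /cross_at /upper /=; apply/idP/idP => //; lra.
Qed.

(* The position of [cross_at a i j] in the order -a < 0 < a, for a > 0. *)
Definition cross_rank (i j : 'I_3) : nat :=
  nth 0%N (nth [::] [:: [:: 1; 1; 0]; [:: 1; 1; 2]; [:: 0; 2; 1]]%N i) j.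

Lemma cross_at_lt (a : R) i j k : 0 < a ->
  (cross_at a i j < cross_at a i k) = (cross_rank i j < cross_rank i k)%N.
Proof.
by move=> a0; elim/ord3P: i; elim/ord3P: j; elim/ord3P: k; rewrite /cross_at /cross_rank /=;
  rewrite ?ltxx //; first [by apply/negbTE; rewrite -leNgt; lra | by refine (_ : _ = true); lra].
Qed.

Lemma cross_atN (a : R) i j : cross_at (- a) i j = - cross_at a i j.
Proof. by elim/ord3P: i; elim/ord3P: j; rewrite /cross_at /= ?oppr0. Qed.

End Omega3.

(* [p i] is the sense in which strand [i] is followed, [b] the orientation of
   the chart. *)
Lemma triangle_balance (p : 'I_3 -> bool) (b : bool) (i j : 'I_3) : i != j ->
  let e i j : int := if (p i == p j) == (upper i j == b) then -1 else 1 in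
  let before i k j := (if p i then cross_rank i k < cross_rank i j
                       else cross_rank i j < cross_rank i k)%N in
  \sum_(k <- others i | before i k j) e i k - \sum_(k <- others j | before j k i) e j k =
  \sum_(k <- others i | before i j k) e i k - \sum_(k <- others j | before j i k) e j k.
Proof.
(* Only the third strand can be met strictly before the crossing of [i] and [j], so each sum has at
   most one term; the senses and the orientation leave sixteen cases per pair. *)
cbv zeta; elim/ord3P: i; elim/ord3P: j => // _; rewrite /others /= !big_cons !big_nil /upper /cross_rank /=;
by case: (p i0); case: (p i1); case: (p i2); case: b.
Qed.

Lemma Omega3_crossing_sum (R : realType) (S : surface) (V : zmodType)
    (f : int -> int -> V) (K K' : diagram R S) :
  Omega3 K K' -> crossing_sum K f = crossing_sum K' f.
Proof.
move=> [phi [h [m [d [[cphi _] [d0 unit] disj [dK dK'] [out tout]]]]]].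
have pic := @below_picture R; have pic' := @above_picture R.
have d0' i : d i != 0 by apply/eqP.
pose c3 (a : R) i j := (cross_at a i j, (j, cross_at a i j)).
have mem (a : R) i j : i != j -> c3 a i j \in graph_crossings (triangle_crossings a) i.
  by move=> ij; apply/mapP; exists (cross_at a i j, j) => //; apply/triangle_mem.
have crossC (a : R) i j : cross_at a i j = cross_at a j i.
  by elim/ord3P: i; elim/ord3P: j.
pose b := 0 < jacobian_area (S := S) phi 0.
pose e i j : int := if ((0 < d i) == (0 < d j)) == (upper i j == b) then -1 else 1.
have eK i j : i != j -> label_change K (at_pair m d i (c3 (1 / 2) i j)) = e i j.
  move=> ij; rewrite /label_change.
  rewrite (drawing_left_incoming cphi d0 unit disj dK pic (mem _ _ _ ij)).
  by rewrite below_sign.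
have eK' i j : i != j -> label_change K' (at_pair m d i (c3 (- (1 / 2)) i j)) = e i j.
  move=> ij; rewrite /label_change.
  rewrite (drawing_left_incoming cphi d0 unit disj dK' pic' (mem _ _ _ ij)).
  by rewrite above_sign.
have sumE (a : R) (L : diagram R S) i (P : pred R) :
    (forall j, i != j -> label_change L (at_pair m d i (c3 a i j)) = e i j) ->
    \sum_(c <- graph_crossings (triangle_crossings a) i | P c.1)
      label_change L (at_pair m d i c) =
    \sum_(j <- others i | P (cross_at a i j)) e i j.
  move=> eL; rewrite !big_map big_seq_cond [RHS]big_seq_cond.
  by apply: eq_bigr => j /andP[]; rewrite mem_others => /eL ->.
have tot i : \sum_(c <- graph_crossings (triangle_crossings (1 / 2)) i)
      label_change K (at_pair m d i c) =
    \sum_(c <- graph_crossings (triangle_crossings (- (1 / 2))) i)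
      label_change K' (at_pair m d i c).
  rewrite (sumE _ K i predT); last exact: eK.
  by rewrite (sumE _ K' i predT); last exact: eK'.
have half1 a i j : a = 1 / 2 \/ a = - (1 / 2) -> -1 <= (cross_at a i j : R) <= 1.
  by case=> ->; elim/ord3P: i; elim/ord3P: j; rewrite /cross_at /=; apply/andP; split; lra.
have lab i j : i != j ->
    label K (m i + d i * cross_at (1 / 2) i j) -
      \sum_(k <- others i | d i * cross_at (1 / 2) i k < d i * cross_at (1 / 2) i j) e i k =
    label K' (m i + d i * cross_at (- (1 / 2)) i j) -
      \sum_(k <- others i | d i * cross_at (- (1 / 2)) i k < d i * cross_at (- (1 / 2)) i j) e i k.
  move=> ij.
  have := drawing_label cphi d0 unit disj dK dK' pic pic' out tout tot i
    (half1 _ i j (or_introl erefl)) (half1 _ i j (or_intror erefl)).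
  rewrite (sumE _ K i (fun x => d i * x < d i * cross_at (1 / 2) i j)); last exact: eK.
  by rewrite (sumE _ K' i (fun x => d i * x < d i * cross_at (- (1 / 2)) i j)); last exact: eK'.
have weightK i j : i != j ->
    weight K (at_pair m d i (c3 (1 / 2) i j)) = weight K' (at_pair m d i (c3 (- (1 / 2)) i j)).
  move=> ij; rewrite [LHS]weightE [RHS]weightE (eK i j ij) (eK' i j ij).
  apply: (f_equal2 _ _ erefl).
  have cj a : m j + d j * cross_at a i j = m j + d j * cross_at a j i by rewrite (crossC a i j).
  rewrite [LHS]/= [RHS]/= !cj.
  have := lab i j ij; have := lab j i; rewrite eq_sym => /(_ ij).
  move: (label K _) (label K _) (label K' _) (label K' _) => l1 l2 l3 l4.
  (* The weight involves the two labels only through their difference, so by [lab] it is enough to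
     compare what each strand has met inside the disk. *)
  suff : \sum_(k <- others i | d i * cross_at (1 / 2) i k < d i * cross_at (1 / 2) i j) e i k -
     \sum_(k <- others j | d j * cross_at (1 / 2) j k < d j * cross_at (1 / 2) j i) e j k =
     \sum_(k <- others i | d i * cross_at (- (1 / 2)) i k < d i * cross_at (- (1 / 2)) i j) e i k -
     \sum_(k <- others j | d j * cross_at (- (1 / 2)) j k < d j * cross_at (- (1 / 2)) j i) e j k.
    lia.
  have lt1 k l n : (d k * cross_at (1 / 2) k l < d k * cross_at (1 / 2) k n) =
      (if (0 < d k)%R then cross_rank k l < cross_rank k n else cross_rank k n < cross_rank k l)%N.
    by rewrite (ltr_mull _ _ (d0' k)) !cross_at_lt //; lra.
  have lt2 k l n : (d k * cross_at (- (1 / 2)) k l < d k * cross_at (- (1 / 2)) k n) =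
      (if (0 < d k)%R then cross_rank k n < cross_rank k l else cross_rank k l < cross_rank k n)%N.
    by rewrite (ltr_mull _ _ (d0' k)) !cross_atN !ltrN2 !cross_at_lt //; lra.
  rewrite (eq_bigl _ _ (fun k => lt1 i k j)) (eq_bigl _ _ (fun k => lt1 j k i)).
  rewrite (eq_bigl _ _ (fun k => lt2 i k j)) (eq_bigl _ _ (fun k => lt2 j k i)).
  exact: triangle_balance.
apply: (drawing_crossing_sum cphi d0 unit disj dK dK' pic pic' out tout tot).
apply: eq_bigr => i _; rewrite !big_map big_seq_cond [RHS]big_seq_cond.
apply: eq_big => j; last first.
  move=> /andP[]; rewrite mem_others => ij _.
  by rewrite !sgnE weightK // eK // eK'.
case: (boolP (j \in others i)) => //; rewrite mem_others => ij.
(* The layers [h] are common to both pictures, so the same strand is above at corresponding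
   crossings. *)
by rewrite (drawing_tag dK pic (mem _ _ _ ij) ij) (drawing_tag dK' pic' (mem _ _ _ ij) ij).
Qed.

(** * All moves together, and the specialization to the polynomial *)

Section Invariance.
Context {R : realType} {S : surface} {V : zmodType} (f : int -> int -> V).
Hypothesis f0 : forall e, f 0 e = 0.
Hypothesis fN : forall w e, f w (- e) = - f w e.

Lemma omega_step_crossing_sum (K K' : diagram R S) :
  omega_step K K' -> crossing_sum K f = crossing_sum K' f.
Proof.
case.
- exact: isotopic_crossing_sum.
- exact: reparametrized_crossing_sum.
- exact: Omega1_crossing_sum.
- exact: Omega2_crossing_sum.
- exact: Omega3_crossing_sum.
Qed.

Lemma virtual_step_crossing_sum (K K' : diagram R S) :
  virtual_step K K' -> crossing_sum K f = crossing_sum K' f.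
Proof.
case.
- exact: omega_step_crossing_sum.
- exact: detour_crossing_sum.
- exact: Omega_v_crossing_sum.
Qed.

End Invariance.

Lemma invariant_clos (T U : Type) (step : T -> T -> Prop) (inv : T -> U) :
  (forall x y, step x y -> inv x = inv y) ->
  forall x y, clos_refl_sym_trans T step x y -> inv x = inv y.
Proof.
move=> H x y; elim=> {x y} [x y|x|x y _ ->|x y z _ -> _ ->] //; exact: H.
Qed.

Definition affine_index_term (w e : int) : {fraction {poly int}} := (tvar ^ w - 1) *~ e.

Lemma affine_index_term0 e : affine_index_term 0 e = 0.
Proof. by rewrite /affine_index_term expr0z subrr mul0rz. Qed.

Lemma affine_index_termN w e : affine_index_term w (- e) = - affine_index_term w e.
Proof. exact: mulrNz. Qed.

Lemma affine_index_polynomial_eq (R : realType) (S : surface) (K K' : diagram R S) :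
  crossing_sum K affine_index_term = crossing_sum K' affine_index_term ->
  affine_index_polynomial K = affine_index_polynomial K'.
Proof. by move=> e; exact: e. Qed.

Theorem theorem4p8 (R : realType) :
  (forall K K' : diagram R S2,
     virtually_equivalent K K' ->
     affine_index_polynomial K = affine_index_polynomial K') /\
  (forall (S : surface) (K K' : diagram R S),
     classical K -> classical K' ->
     classically_equivalent K K' ->
     affine_index_polynomial K = affine_index_polynomial K').
Proof.
split=> [K K'|S K K' _ _].
  move=> KK'; apply: affine_index_polynomial_eq.
  apply: (invariant_clos (inv := fun L => crossing_sum L affine_index_term) _ KK') => L L'.
  exact: (virtual_step_crossing_sum (f := affine_index_term) affine_index_term0 affine_index_termN).
move=> KK'; apply: affine_index_polynomial_eq.
apply: (invariant_clos (inv := fun L => crossing_sum L affine_index_term) _ KK') => L L' [_ _].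
exact: (omega_step_crossing_sum (f := affine_index_term) affine_index_term0 affine_index_termN).
Qed.
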